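(* Let $\mathbf w$ be the Chevalley involution automorphism of $\mathcal G$, and let $\varphi:\mathcal G(\pi)\to\mathcal G(\theta)$ be the isomorphism of affine Lie algebras described in the context. Then the following hold. (1) $\varphi(C)=C$. (2) $\varphi(x_\alpha\otimes t^{r_0})=x_\alpha\otimes t^{N(\alpha)+\frac mKr_0}$, where $x_\alpha\otimes t^{r_0}$ is a real root vector of $\mathcal G(\pi)$ and $N(\alpha)$ is an integer independent of $r_0$ but depending on $\alpha$. (3) Let $h_\alpha=[x_\alpha,\mathbf w(x_\alpha)]$. Then, for $h_\alpha\otimes t^{r_0}\in\mathcal G(\pi)$, $$\varphi(h_\alpha\otimes t^{r_0})=h_\alpha\otimes t^{\frac mKr_0}+\langle x_\alpha,\mathbf w(x_\alpha)\rangle\frac{N(\alpha)}{m}\delta_{r_0,0}\,C .$$ (4) $\langle x_\alpha,x_\beta\rangle\ne0$ implies $N(\alpha)+N(\beta)=0$. (5) If $\langle x_\alpha,x_\beta\rangle=0$, then, for real root vectors $x_\alpha\otimes t^{r_0},x_\beta\otimes t^{s_0}$ of $\mathcal G(\pi)$, $$\varphi([x_\alpha,x_\beta]\otimes t^{r_0+s_0})=[x_\alpha,x_\beta]\otimes t^{(r_0+s_0)\frac mK+N(\alpha)+N(\beta)}$$ (here $[x_\alpha,x_\beta]$ could be part of a real or an imaginary root).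
   Context: $\mathcal G$ is a simple finite dimensional complex Lie algebra with non-degenerate invariant symmetric form $\langle\,,\rangle$. $\pi$ is an automorphism of order $K\in\{1,2,3\}$ induced by a Dynkin diagram automorphism with respect to a Cartan subalgebra $\underline h$; $\epsilon$ is a primitive $K$-th root of unity; $\mathcal G_{[i]}=\{x\in\mathcal G:\pi x=\epsilon^ix\}$. $\mathcal G_{[0]}$ is simple and $\mathcal G_{[1]},\mathcal G_{[-1]}$ are irreducible contragredient $\mathcal G_{[0]}$-modules. $\underline t\subset\underline h$ is a Cartan subalgebra of $\mathcal G_{[0]}$; $H_j,E_j,F_j$ ($1\le j\le\ell$) are corresponding canonical generators of $\mathcal G_{[0]}$. $E_0$ is a lowest weight vector of $\mathcal G_{[1]}$ and $F_0$ a highest weight vector of $\mathcal G_{[-1]}$, normalized so that $[H_0,E_0]=2E_0$ where $H_0=[E_0,F_0]$. $\psi_1,\dots,\psi_\ell\in\underline t^*$ are the simple roots of $\mathcal G_{[0]}$, $\psi_0\in\underline t^*$ is the lowest weight of $\mathcal G_{[1]}$. $A_{ij}=\psi_j(H_i)$ ($0\le i,j\le\ell$) is an indecomposable affine Cartan matrix, and $(a_0,\dots,a_\ell)$, $(a^1_0,\dots,a^1_\ell)$ are the coprime positive integer vectors with $(A_{ij})(a_0,\dots,a_\ell)^T=0$ and $(a_0^1,\dots,a_\ell^1)(A_{ij})=0$; $a_0=1$ always. The form is normalized by $\langle\psi_0,\psi_0\rangle=2a_0^1/K$ (form on $\underline t^*$ induced from the nonsingular restriction to $\underline t$). Let $m=K\sum_{j=0}^\ell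 a_j$, let $\omega$ be a primitive $m$-th root of unity, and let $\theta$ be the automorphism of $\mathcal G$, of order $m$, with $\theta H_i=H_i$, $\theta E_j=\omega E_j$ ($0\le i,j\le\ell$). Affine algebras: $\mathcal G(\pi)=\bigoplus_{i\in\mathbb Z}\mathcal G_{[i]}\otimes t^i\oplus\mathbb CC$ with $C$ central and $[x\otimes t^i,y\otimes t^j]=[x,y]\otimes t^{i+j}+\frac{\langle x,y\rangle}{K}i\,\delta_{i+j,0}C$; $\mathcal G(\theta)=\bigoplus_{i\in\mathbb Z}\{x\in\mathcal G:\theta x=\omega^ix\}\otimes t^i\oplus\mathbb CC$ with the same bracket but with $\frac1m\langle\,,\rangle$ in place of $\frac1K\langle\,,\rangle$. In $\mathcal G(\theta)$ put $e_j=E_j\otimes t$, $f_j=F_j\otimes t^{-1}$, $h_j=H_j\otimes1+2\langle\psi_j,\psi_j\rangle^{-1}m^{-1}C$ ($0\le j\le\ell$). The (known) isomorphism $\varphi:\mathcal G(\pi)\to\mathcal G(\theta)$ is determined by $\varphi(E_i\otimes1)=e_i$, $\varphi(F_i\otimes1)=f_i$, $\varphi(H_i)=h_i$ for $1\le i\le\ell$, $\varphi(E_0\otimes t)=e_0$, $\varphi(F_0\otimes t^{-1})=f_0$, $\varphi(H_0+\frac{\langle E_0,F_0\rangle}{K}C)=h_0$. A real root vector $x_\alpha\otimes t^{r_0}$ of $\mathcal G(\pi)$ is one with $0\neq x_\alpha\in\mathcal G_{[r_0]}$ of nonzero $\underline t$-weight $\alpha$; in (4) and (5) $x_\alpha,x_\beta$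 are elements occurring in real root vectors. *)

(* Defs.v *)
From HB Require Import structures.
From mathcomp Require Import all_boot all_order all_algebra all_fingroup.
From mathcomp Require Import sesquilinear finmap reals complex monalg.

Set Implicit Arguments.
Unset Strict Implicit.
Unset Printing Implicit Defensive.

Import Order.TTheory GRing.Theory Num.Theory.
Local Open Scope ring_scope.

HB.mixin Record Lmodule_isLie (k : fieldType) g of GRing.Lmodule k g := {
  lie_bracket : g -> g -> g;
  lie_linearl : forall y, linear (lie_bracket^~ y);
  lie_linearr : forall x, linear (lie_bracket x);
  liexx : forall x, lie_bracket x x = 0;
  lie_jacobi : forall x y z,
    lie_bracket x (lie_bracket y z) + lie_bracket y (lie_bracket z x)
      + lie_bracket z (lie_bracket x y) = 0
}.

#[short(type="lieAlgType")]
HB.structure Definition Lie (k : fieldType) :=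
  {g of GRing.Lmodule k g & Lmodule_isLie k g}.

#[short(type="finLieAlgType")]
HB.structure Definition FinLie (k : fieldType) :=
  {g of Vector k g & Lmodule_isLie k g}.

Notation "[ 'lie' x , y ]" := (lie_bracket x y)
  (format "[ 'lie'  x ,  y ]") : ring_scope.

Notation leigenspace := passmx.leigenspace.

Lemma linear_linfunE (k : fieldType) (U V : vectType k) (f : U -> V) :
  linear f -> linfun f =1 f.
Proof.
move=> lin_f; pose L := GRing.isLinear.Build _ _ _ _ _ lin_f.
pose f' : {linear U -> V} := HB.pack f L.
exact: (lfunE f').
Qed.

Section LieAlgebra.
Variables (k : fieldType) (g : finLieAlgType k).
Implicit Types (A M N T U V I : {vspace g}) (x y z : g).

Definition stable_under A M : Prop :=
  forall x y, x \in A -> y \in M -> [lie x, y] \in M.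

Definition subalgebra A : Prop := stable_under A A.

Definition irreducible_module A M : Prop :=
  [/\ stable_under A M, M != 0%VS
    & forall N, (N <= M)%VS -> stable_under A N -> N = 0%VS \/ N = M].

Definition simple_algebra A : Prop :=
  [/\ subalgebra A,
      exists x y, [/\ x \in A, y \in A & [lie x, y] != 0]
    & forall I, (I <= A)%VS -> stable_under A I -> I = 0%VS \/ I = A].

Definition dual U : vectType k := 'Hom(subvs_of U, k^o).

(* N is isomorphic, as an A-module under the bracket, to the dual of M.
   vsproj only casts back to a subspace type: for stable M and N the brackets
   below already lie in M and N. *)
Definition contragredient A M N : Prop :=
  exists f : 'Hom(subvs_of N, dual M), bijective f /\
    forall (a : g) (x : subvs_of M) (y : subvs_of N), a \in A ->
      f (vsproj N [lie a, vsval y]) x = - f y (vsproj M [lie a, vsval x]).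

Definition lie_span U V : {vspace g} :=
  <<[seq [lie x, y] | x <- vbasis U, y <- vbasis V]>>%VS.

Definition nilpotent_algebra T : Prop := exists c, iter c (lie_span T) T = 0%VS.

Definition cartan_subalgebra A T : Prop :=
  [/\ (T <= A)%VS, subalgebra T, nilpotent_algebra T
    & forall x, x \in A -> (forall y, y \in T -> [lie x, y] \in T) -> x \in T].

Definition automorphism (s : 'End(g)) : Prop :=
  bijective s /\ forall x y, s [lie x, y] = [lie s x, s y].

Definition has_order (s : 'End(g)) (d : nat) : Prop :=
  [/\ (0 < d)%N, forall x, iter d s x = x
    & forall c, (0 < c < d)%N -> exists x, iter c s x != x].

Definition eigenpiece (s : 'End(g)) (z : k) (i : int) : {vspace g} :=
  leigenspace s (z ^ i).

Definition weight_vector T (al : dual T) x : Prop :=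
  forall h : subvs_of T, [lie vsval h, x] = (al h : k) *: x.

Definition root A T (al : dual T) : Prop :=
  al != 0 /\ exists x, [/\ x \in A, x != 0 & weight_vector al x].

Definition simple_roots A T l (psi : 'I_l -> dual T) : Prop :=
  [/\ forall j, root A (psi j),
      basis_of fullv (codom psi)
    & forall al, root A al -> exists c : 'I_l -> nat,
        al = \sum_j psi j *+ c j \/ al = - \sum_j psi j *+ c j].

Definition generated_by A (S : g -> Prop) : Prop :=
  [/\ subalgebra A, forall x, S x -> x \in A
    & forall U, subalgebra U -> (forall x, S x -> x \in U) -> (A <= U)%VS].

Definition canonical_generators A T l (psi : 'I_l -> dual T)
    (H : 'I_l -> subvs_of T) (E F : 'I_l -> g) : Prop :=
  [/\ simple_roots A psi,
      forall j, [/\ E j \in A, F j \in A,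
        weight_vector (psi j) (E j) & weight_vector (- psi j) (F j)],
      forall i j, [lie E i, F j] = if i == j then vsval (H i) else 0,
      forall j, psi j (H j) = 2
    & generated_by A
        (fun x => exists j, [\/ x = vsval (H j), x = E j | x = F j])].

(* With X the lowering (resp. raising) generators, x is a lowest (resp.
   highest) weight vector of M, of weight al. *)
Definition extremal_weight_vector M T l (X : 'I_l -> g) (al : dual T) x : Prop :=
  [/\ x \in M, x != 0, weight_vector al x & forall j, [lie X j, x] = 0].

Definition diagram_automorphism T n (al : 'I_n -> dual T)
    (H : 'I_n -> subvs_of T) (e f : 'I_n -> g) (s : 'End(g)) : Prop :=
  automorphism s /\ exists p : {perm 'I_n},
    [/\ forall i j, al (p j) (H (p i)) = al j (H i),
        forall i, s (e i) = e (p i) & forall i, s (f i) = f (p i)].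

Definition chevalley_involution T n (H : 'I_n -> subvs_of T)
    (e f : 'I_n -> g) (w : 'End(g)) : Prop :=
  automorphism w /\ forall i, [/\ w (e i) = - f i, w (f i) = - e i
    & w (vsval (H i)) = - vsval (H i)].

(* x (x) t^r is a real root vector of the affine algebra twisted by s *)
Definition real_root_vector (s : 'End(g)) (z : k) T (al : dual T) (r : int) x
    : Prop :=
  [/\ x \in eigenpiece s z r, x != 0, weight_vector al x & al != 0].

Variable B : {symmetric g}.

Definition invariant_form : Prop :=
  forall x y z, B [lie x, y] z = B x [lie y, z].

Definition flat T : 'Hom(subvs_of T, dual T) :=
  linfun (fun x : subvs_of T =>
    linfun (fun y : subvs_of T => B (vsval x) (vsval y) : k^o)).

Lemma flatE T (x y : subvs_of T) : flat T x y = B (vsval x) (vsval y).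
Proof.
have lin2 (u : subvs_of T) :
    linear (fun v : subvs_of T => B (vsval u) (vsval v) : k^o).
  by move=> c v v'; rewrite !linearP.
rewrite linear_linfunE ?linear_linfunE // => c u u'.
apply/lfunP => v.
by rewrite add_lfunE scale_lfunE !linear_linfunE // linearP linearPl.
Qed.

(* The form induced on the dual of T when B is nonsingular on T: then flat T is
   bijective and (flat T)^-1 its two-sided inverse. *)
Definition dual_form T (al be : dual T) : k :=
  B (vsval ((flat T)^-1%VF al)) (vsval ((flat T)^-1%VF be)).

End LieAlgebra.

Section AffineMatrix.
Variables (R : realFieldType) (n : nat) (A : 'M[int]_n).

Definition generalized_cartan_matrix : Prop :=
  [/\ forall i, A i i = 2, forall i j, i != j -> A i j <= 0
    & forall i j, A i j = 0 -> A j i = 0].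

Definition indecomposable_matrix : Prop :=
  forall J : {set 'I_n}, J != set0 -> J != setT ->
    exists i j, [/\ i \in J, j \notin J & A i j != 0].

Definition affine_cartan_matrix : Prop :=
  let AR : 'M[R]_n := map_mx intr A in
  [/\ generalized_cartan_matrix, indecomposable_matrix,
      (\rank AR).+1 = n,
      exists2 u : 'cV[R]_n, (forall i, 0 < u i 0) & AR *m u = 0
    & forall v : 'cV[R]_n, (forall i, 0 <= (AR *m v) i 0) -> AR *m v = 0].

End AffineMatrix.

Definition coprime_positive n (a : 'I_n -> nat) : Prop :=
  (forall j, (0 < a j)%N) /\ \big[gcdn/0%N]_j a j = 1%N.

Section LoopAlgebra.
Variables (k : fieldType) (g : finLieAlgType k).

(* g (x) k[t, t^-1], as finitely supported g-valued functions on int. *)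
Definition loop : Type := {malg g[int]}.

HB.instance Definition _ := GRing.Zmodule.on loop.

Definition loop_scale (c : k) (u : loop) : loop :=
  \sum_(i <- msupp u) << c *: u@_i *g i >>.

Lemma loop_scaleE c (u : loop) i : (loop_scale c u)@_i = c *: u@_i.
Proof.
rewrite raddf_sum [in RHS](monalgE u) raddf_sum scaler_sumr.
by apply: eq_bigr => j _; rewrite /= !mcoeffU scalerMnr.
Qed.

Fact loop_scaleA c d (u : loop) :
  loop_scale c (loop_scale d u) = loop_scale (c * d) u.
Proof. by apply/malgP => i; rewrite !loop_scaleE scalerA. Qed.

Fact loop_scale1 : left_id 1 loop_scale.
Proof. by move=> u; apply/malgP => i; rewrite loop_scaleE scale1r. Qed.

Fact loop_scaleDr : right_distributive loop_scale +%R.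
Proof.
by move=> c u v; apply/malgP => i; rewrite !(loop_scaleE, mcoeffD) scalerDr.
Qed.

Fact loop_scaleDl (u : loop) : {morph loop_scale^~ u : c d / c + d}.
Proof.
by move=> c d; apply/malgP => i; rewrite !(loop_scaleE, mcoeffD) scalerDl.
Qed.

HB.instance Definition _ := GRing.Zmodule_isLmodule.Build k loop
  loop_scaleA loop_scale1 loop_scaleDr loop_scaleDl.

Definition affine : lmodType k := (loop * k^o)%type.

Definition monomial (x : g) (i : int) : affine := (<< x *g i >> : loop, 0).

Definition affineC : affine := (0, 1).

End LoopAlgebra.

Arguments affineC {k g}.
Notation "x '\*t^' i" := (monomial x i)
  (at level 39, left associativity) : ring_scope.

Section AffineAlgebra.
Variables (k : fieldType) (g : finLieAlgType k).
Implicit Types (x y : g).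
Variable B : {symmetric g}.

Definition affine_bracket (d : nat) (u v : affine g) : affine g :=
  \sum_(i <- msupp u.1) \sum_(j <- msupp v.1) [lie u.1@_i, v.1@_j] \*t^ (i + j)
  + (\sum_(i <- msupp u.1) B u.1@_i v.1@_(- i) / d%:R * i%:~R) *: affineC.

Lemma sum_msuppU (V : nmodType) (F : int -> V) (x : g) (i : int) :
  (x = 0 -> F i = 0) -> \sum_(j <- msupp << x *g i >>) F j = F i.
Proof.
rewrite msuppU; case: eqP => [x0 Fi0|_ _].
  by rewrite big_seq_fset0 Fi0.
by rewrite big_seq_fset1.
Qed.

Lemma affine_bracket_monomial d x y (i j : int) :
  affine_bracket d (x \*t^ i) (y \*t^ j) =
  [lie x, y] \*t^ (i + j)
  + (B x y / d%:R * i%:~R * (i + j == 0)%:R) *: affineC.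
Proof.
have lie0x z : [lie 0, z] = 0 :> g.
  by have := lie_linearl z (-1) 0 0; rewrite scaler0 addr0 scaleN1r addNr.
have liex0 z : [lie z, 0] = 0 :> g.
  by have := lie_linearr z (-1) 0 0; rewrite scaler0 addr0 scaleN1r addNr.
have mono0 n : (0 : g) \*t^ n = 0.
  by congr pair; apply/malgP => l; rewrite mcoeffU mul0rn mcoeff0.
rewrite /affine_bracket /= !sum_msuppU ?mcoeffUU.
- rewrite mcoeffU linearMnr -[B x y *+ _]mulr_natr [i + j]addrC addr_eq0.
  by congr (_ + _ *: _); rewrite [_ / _]mulrAC [LHS]mulrAC.
- by move=> ->; rewrite linear0l !mul0r.
- by move=> ->; rewrite liex0 mono0.
- by move=> ->; rewrite lie0x mono0.
- by move=> ->; rewrite liex0 mono0.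
Qed.

Lemma affine_bracketC d (u : affine g) : affine_bracket d affineC u = 0.
Proof. by rewrite /affine_bracket /= msupp0 !big_seq_fset0 scale0r addr0. Qed.

(* The subspace (+)_i {x | s x = z^i x} (x) t^i (+) k C. *)
Definition twisted (s : 'End(g)) (z : k) (u : affine g) : Prop :=
  forall i : int, u.1@_i \in eigenpiece s z i.

(* phi restricts to an isomorphism of Lie algebras from
   (twisted s z, affine_bracket d) to (twisted s' z', affine_bracket d');
   its values outside twisted s z are irrelevant. *)
Record affine_isomorphism (s : 'End(g)) (z : k) (d : nat)
    (s' : 'End(g)) (z' : k) (d' : nat) (phi : affine g -> affine g) : Prop := {
  iso_codom : forall u, twisted s z u -> twisted s' z' (phi u);
  iso_linear : forall c u v, twisted s z u -> twisted s z v ->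
    phi (c *: u + v) = c *: phi u + phi v;
  iso_bracket : forall u v, twisted s z u -> twisted s z v ->
    phi (affine_bracket d u v) = affine_bracket d' (phi u) (phi v);
  iso_inj : forall u v, twisted s z u -> twisted s z v ->
    phi u = phi v -> u = v;
  iso_surj : forall v, twisted s' z' v -> exists2 u, twisted s z u & phi u = v
}.

End AffineAlgebra.

(* Main.v *)
Require Import Defs.
From mathcomp Require Import all_boot all_order all_algebra all_fingroup.
From mathcomp Require Import sesquilinear finmap reals complex monalg.
From mathcomp Require Import boolp ring zify.

Set Implicit Arguments.
Unset Strict Implicit.
Unset Printing Implicit Defensive.

Import Order.TTheory GRing.Theory Num.Theory.
Local Open Scope ring_scope.

(** Pick the element rho of t with psi_j(rho) = 1 for j >= 1, and put
M = m / K = a_0 + ... + a_l.  Since the labels annihilate the Cartan matrix,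
the sum of the a_j psi_j vanishes, so psi_0(rho) = 1 - M.  Hence on each of the
generators E_j, F_j the isomorphism moves the exponent r to N + M r, where N is
the eigenvalue of ad rho.  This is the formula of the theorem, with N(al) the
height al(rho), and everything amounts to carrying it from the generators to
all root vectors.

No decomposition into eigenvectors is needed for that.  Write the loop part of
phi(x t^r) as the sum of the u_i t^i, and call x lifted if the u_i add up to x
and [rho, u_i] = (i - M r) u_i for all i ([loop_lift], [lifted]).  Both conditions are
linear in x and compatible with brackets, because evaluation at t = 1 is a
homomorphism of Lie algebras.  If moreover [rho, x] = c x, comparing the two
eigenvalue equations leaves a single exponent i = c + M r, with u_i = x; in
particular c is an integer ([phi_real_root]).

To see that every x in g_[r] is lifted ([lifted_all]), go up from g_[0] by
bracketing with E_0 and down by bracketing with F_0.  The lifted elements of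
g_[r + 1] form a submodule of an irreducible module, so it is enough that
ad E_0 does not kill g_[r].  For r = 0 and r = -1 modulo K this is seen on H_0
and on F_0.  In the case r = 1 ([affine_generator_acts]) suppose that E_0 kills
g_[1].  A highest weight vector y of g_[1] is then killed by all of
E_0, ..., E_l, so its weight takes nonnegative integral values on H_0, ..., H_l
by sl2 theory.  The a^1_j H_j add up to 0 and a^1_j > 0, so these values are
all 0; y is then invariant under g_[0], so g_[1] is the line of y and H_0 acts
on it by 0, against [H_0, E_0] = 2 E_0.

The central terms rest on phi(C) = C ([phi_center]), which follows by applying
phi to the relation a^1_0 H_0 + ... + a^1_l H_l = 0: by the proportionality of
a^1_j <E_j, F_j> and a_j ([label_proportion]) the central terms on the two sides
agree.  A real root vector x has no central term in its image because it is a
multiple of [h, x] with h in t.  The formula for h_al and the one for brackets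
then follow by expanding a bracket of two root vectors in both algebras, once
it is known that w acts by -1 on h and commutes with pi. *)

(** * Linear algebra *)

Section LinearAlgebra.
Variables (k : fieldType) (V : vectType k).

(** A subspace of maximal dimension among those contained in P is all of P. This
turns linear conditions on vectors into objects of type {vspace V}, to which
irreducibility and generation apply. *)
Lemma closed_predicate_vspace (P : V -> Prop) :
  P 0 -> (forall c x y, P x -> P y -> P (c *: x + y)) ->
  exists U : {vspace V}, forall x, x \in U <-> P x.
Proof.
move=> P0 Plin.
suff ext d (U : {vspace V}) : (\dim {:V} - \dim U <= d)%N ->
    (forall x, x \in U -> P x) ->
    exists U' : {vspace V}, forall x, x \in U' <-> P x.
  apply: (ext (\dim {:V}) 0%VS); first by rewrite dimv0 subn0.
  by move=> x; rewrite memv0 => /eqP->.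
elim: d U => [|d IHd] U leUd sUP.
  exists U => x; split=> [/sUP//|_].
  suff /eqP-> : U == fullv by rewrite memvf.
  by rewrite eqEdim subvf -subn_eq0 -leqn0.
have [[x [Px xNU]]|noext] := pselect (exists x, P x /\ x \notin U); last first.
  exists U => x; split=> [/sUP//|Px]; apply/negPn/negP => xNU.
  by apply: noext; exists x.
apply: (IHd (<[x]> + U)%VS).
  have ltU : (\dim U < \dim (<[x]> + U))%N.
    rewrite ltn_neqAle dimvS ?addvSr // andbT; apply: contra xNU => /eqP eqd.
    have /eqP-> : U == (<[x]> + U)%VS by rewrite eqEdim addvSr -eqd leqnn.
    by apply: (subvP (addvSl _ _)); apply: memv_line.
  rewrite -ltnS; apply: leq_trans leUd; rewrite ltn_sub2l //.
  exact: leq_trans ltU (dimvS (subvf _)).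
move=> y /memv_addP[u /vlineP[c ->] [v vU ->]]; apply: Plin => //.
exact: sUP.
Qed.

(** The characteristic polynomial has finitely many roots. This is the only way in
which finite dimension enters the highest weight arguments. *)
Lemma eigenvector_sequence (D : V -> V) (c : nat -> k) (y : nat -> V) :
  linear D -> injective c -> (forall i, D (y i) = c i *: y i) ->
  exists i, y i = 0.
Proof.
move=> linD injc Dy; apply: contrapT => nz.
have {}nz i : y i != 0 by apply/eqP => yi0; apply: nz; exists i.
pose D' := linfun D; pose e := vbasis {:V}.
have eb : basis_of fullv e := vbasisP _.
pose M := passmx.mxof e e D'.
have evM i : root (char_poly M) (c i).
  rewrite -eigenvalue_root_char; apply/eigenvalueP.
  exists (passmx.rVof e (y i)); last by rewrite passmx.rVof_eq0.
  rewrite -passmx.rVof_app // linear_linfunE // Dy.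
  by apply/rowP => j; rewrite !mxE linearZ.
have := @max_poly_roots _ (char_poly M) (mkseq c (size (char_poly M))).
rewrite monic_neq0 ?char_poly_monic // size_mkseq ltnn => /(_ isT) contra.
suff: false by []. apply: contra.
  by apply/allP => _ /mapP[i _ ->]; apply: evM.
by rewrite mkseq_uniq.
Qed.

End LinearAlgebra.

(** * Lie algebras *)

Section LieTheory.
Variables (k : fieldType) (g : finLieAlgType k).
Implicit Types (x y z : g) (A M : {vspace g}).

Lemma lie0r x : [lie x, 0] = 0 :> g.
Proof. by have := lie_linearr x (-1) 0 0; rewrite scaler0 addr0 scaleN1r addNr. Qed.

Lemma lieDr x y z : [lie x, y + z] = [lie x, y] + [lie x, z].
Proof. by have := lie_linearr x 1 y z; rewrite !scale1r. Qed.

Lemma lieZr c x y : [lie x, c *: y] = c *: [lie x, y].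
Proof. by have := lie_linearr x c y 0; rewrite !addr0 lie0r addr0. Qed.

Lemma lieNr x y : [lie x, - y] = - [lie x, y].
Proof. by rewrite -!scaleN1r lieZr. Qed.

Lemma lie_sumr x I r (P : pred I) (F : I -> g) :
  [lie x, \sum_(i <- r | P i) F i] = \sum_(i <- r | P i) [lie x, F i].
Proof. exact: (big_morph _ (lieDr x) (lie0r x)). Qed.

Lemma lie0l x : [lie 0, x] = 0 :> g.
Proof. by have := lie_linearl x (-1) 0 0; rewrite scaler0 addr0 scaleN1r addNr. Qed.

Lemma lieDl x y z : [lie x + y, z] = [lie x, z] + [lie y, z].
Proof. by have := lie_linearl z 1 x y; rewrite !scale1r. Qed.

Lemma lieZl c x y : [lie c *: x, y] = c *: [lie x, y].
Proof. by have := lie_linearl y c x 0; rewrite !addr0 lie0l addr0. Qed.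

Lemma lieNl x y : [lie - x, y] = - [lie x, y].
Proof. by rewrite -!scaleN1r lieZl. Qed.

Lemma lie_suml I r (P : pred I) (F : I -> g) y :
  [lie \sum_(i <- r | P i) F i, y] = \sum_(i <- r | P i) [lie F i, y].
Proof. exact: (big_morph (lie_bracket^~ y) (fun x z => lieDl x z y) (lie0l y)). Qed.

Lemma lieC x y : [lie x, y] = - [lie y, x].
Proof.
have := liexx (x + y); rewrite !(lieDl, lieDr) !liexx add0r addr0.
by move/eqP; rewrite addr_eq0 => /eqP.
Qed.

Lemma lie_leibniz x y z :
  [lie x, [lie y, z]] = [lie [lie x, y], z] + [lie y, [lie x, z]].
Proof.
have := lie_jacobi x y z; rewrite (lieC z x) lieNr (lieC z).
by move/eqP; rewrite subr_eq0 => /eqP <-; rewrite subrK.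
Qed.

Lemma mem_eigenpiece (s : 'End(g)) (z : k) (i : int) x :
  (x \in eigenpiece s z i) = (s x == z ^ i *: x).
Proof.
by rewrite /eigenpiece memv_ker add_lfunE opp_lfunE scale_lfunE id_lfunE subr_eq0.
Qed.

Lemma lie_eigenpiece (s : 'End(g)) (z : k) (i j : int) x y :
  automorphism s -> z != 0 -> x \in eigenpiece s z i -> y \in eigenpiece s z j ->
  [lie x, y] \in eigenpiece s z (i + j).
Proof.
move=> [_ sM] z0; rewrite !mem_eigenpiece sM => /eqP-> /eqP->.
by rewrite lieZl lieZr scalerA expfzDr.
Qed.

Lemma generated_by_closed A (S P : g -> Prop) :
  generated_by A S -> P 0 -> (forall c x y, P x -> P y -> P (c *: x + y)) ->
  (forall x y, P x -> P y -> P [lie x, y]) -> (forall x, S x -> P x) ->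
  forall x, x \in A -> P x.
Proof.
move=> [_ _ genA] P0 Plin Plie SP x xA.
have [U UP] := closed_predicate_vspace P0 Plin.
apply/UP/(subvP (genA U _ _)) => //; first by move=> y z /UP Py /UP Pz; apply/UP/Plie.
by move=> y /SP /UP.
Qed.

Lemma generated_by_centralize A (S : g -> Prop) y :
  generated_by A S -> (forall x, S x -> [lie x, y] = 0) ->
  forall x, x \in A -> [lie x, y] = 0.
Proof.
move=> genA Sy; apply: (generated_by_closed genA) => //; first exact: lie0l.
  by move=> c u v uy vy; rewrite lieDl lieZl uy vy scaler0 addr0.
move=> u v uy vy; apply/eqP.
by have := lie_leibniz u v y; rewrite uy vy !lie0r addr0 => <-.
Qed.

(** The vectors of M satisfying P form a nonzero submodule. *)
Lemma irreducible_module_closed A M (P : g -> Prop) :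
  irreducible_module A M ->
  P 0 -> (forall c x y, P x -> P y -> P (c *: x + y)) ->
  (forall x y, x \in A -> y \in M -> P y -> P [lie x, y]) ->
  (exists x, [/\ x \in M, x != 0 & P x]) ->
  forall x, x \in M -> P x.
Proof.
move=> [stM _ irrM] P0 Plin Plie [z [zM z0 Pz]] x xM.
have [||U UP] := @closed_predicate_vspace _ g (fun y => y \in M /\ P y).
- by rewrite mem0v.
- by move=> c u v [uM Pu] [vM Pv]; rewrite rpredD ?rpredZ //; split=> //; apply: Plin.
have [||U0|UM] := irrM U.
- by apply/subvP => y /UP[].
- by move=> u v uA /UP[vM Pv]; apply/UP; split; [apply: stM | apply: Plie].
- by move/(UP z): (conj zM Pz); rewrite U0 memv0 (negPf z0).
- by move: xM; rewrite -UM => /UP[].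
Qed.

Lemma simple_algebra_module A : simple_algebra A -> irreducible_module A A.
Proof.
move=> [stA [x [y [xA yA xy0]]] irrA]; split=> //.
apply: contraNneq xy0 => A0; move: xA; rewrite A0 memv0 => /eqP->.
by rewrite lie0l.
Qed.

(** The line of a central element is an ideal; it cannot be the whole algebra, which
is not abelian. *)
Lemma simple_algebra_center0 z :
  simple_algebra (fullv : {vspace g}) -> (forall x, [lie x, z] = 0) -> z = 0.
Proof.
move=> [_ [x [y [_ _ xy0]]] irr] cz.
have [||z0|zf] := irr <[z]>%VS; first exact: subvf.
- by move=> u _ _ /vlineP[c ->]; rewrite lieZr cz scaler0 mem0v.
- by apply/eqP; rewrite -memv0 -z0 memv_line.
- case/eqP: xy0; have := memvf y; rewrite -zf => /vlineP[c ->].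
  by rewrite lieZr cz scaler0.
Qed.

Lemma weight_vectorN (T : {vspace g}) (al : dual T) h x :
  weight_vector (- al) x -> [lie vsval h, x] = - (al h : k) *: x.
Proof. by move=> /(_ h) ->; rewrite opp_lfunE. Qed.

Lemma weight_vector_lie (T : {vspace g}) (al be : dual T) x y :
  weight_vector al x -> weight_vector be y -> weight_vector (al + be) [lie x, y].
Proof.
move=> wx wy h; rewrite lie_leibniz wx wy lieZl lieZr -scalerDl.
by rewrite add_lfunE.
Qed.

End LieTheory.

(** * Representations of sl2 *)

Section Sl2.
Variables (k : numFieldType) (g : finLieAlgType k).

(** The vectors f^i y are eigenvectors of h with distinct eigenvalues c - 2 i, so
one of them vanishes; for the last nonzero one, f^n y, the identity
e f^(n+1) y = (n+1) (c - n) f^n y gives c = n. *)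
Lemma sl2_highest_weight (h e f y : g) (c : k) :
  [lie h, e] = 2 *: e -> [lie h, f] = - 2 *: f -> [lie e, f] = h ->
  [lie h, y] = c *: y -> [lie e, y] = 0 -> y != 0 ->
  exists n : nat, c = n%:R /\ (n = 0%N -> [lie f, y] = 0).
Proof.
move=> he hf ef hy ey y0.
pose v i := iter i (lie_bracket f) y.
have hv i : [lie h, v i] = (c - i%:R * 2) *: v i.
  elim: i => [|i IHi]; first by rewrite mul0r subr0.
  rewrite /= lie_leibniz hf IHi lieZl lieZr -scalerDl; congr (_ *: _).
  by rewrite -natr1; ring.
have ev i : [lie e, v i.+1] = (i.+1%:R * (c - i%:R)) *: v i.
  elim: i => [|i IHi]; first by rewrite /= lie_leibniz ef ey lie0r addr0 hy mul1r subr0.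
  have -> : v i.+2 = [lie f, v i.+1] by [].
  rewrite lie_leibniz ef hv IHi lieZr -scalerDl.
  by congr (_ *: _); rewrite -!natr1; ring.
have [n vn0] : exists n, v n = 0.
  apply: (eigenvector_sequence (lie_linearr h)) hv => i j /addrI /oppr_inj.
  have two0 : 2 != 0 :> k by rewrite pnatr_eq0.
  by move/(mulIf two0)/eqP; rewrite eqr_nat => /eqP.
have exn : exists n, v n == 0 by exists n; apply/eqP.
case: (ex_minnP exn) => -[/= |i] /eqP vi0 mini; first by rewrite vi0 eqxx in y0.
exists i; split; last by move=> i0; move: vi0; rewrite i0.
have vi : v i != 0 by apply/negP => /mini; rewrite ltnn.
have := ev i; rewrite vi0 lie0r => /esym/eqP.
by rewrite scaler_eq0 (negPf vi) orbF mulf_eq0 pnatr_eq0 subr_eq0 => /eqP.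
Qed.

End Sl2.
(** * Evaluation of loops at t = 1 *)

Section LoopEvaluation.
Variables (k : fieldType) (g : finLieAlgType k).
Implicit Types (u v : loop g) (x y : g) (d : int).

Definition eval1 (u : {malg g[int]}) : g := \sum_(i <- msupp u) u@_i.

(** Sums over a common large support are additive term by term. *)
Lemma eval1_wide (D : {fset int}) (u : {malg g[int]}) :
  (msupp u `<=` D)%fset -> eval1 u = \sum_(i <- D) u@_i.
Proof.
move=> sD; apply: big_fset_incl => // i _; exact: mcoeff_outdom.
Qed.

Lemma eval1D (u v : {malg g[int]}) : eval1 (u + v) = eval1 u + eval1 v.
Proof.
set D := (msupp u `|` msupp v)%fset.
rewrite (@eval1_wide D (u + v)) ?msuppD_le // (@eval1_wide D u) ?fsubsetUl //.
rewrite (@eval1_wide D v) ?fsubsetUr // -big_split.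
by apply: eq_bigr => i _; rewrite mcoeffD.
Qed.

Lemma eval10 : eval1 (0 : {malg g[int]}) = 0.
Proof. by rewrite /eval1 msupp0 big_seq_fset0. Qed.

Lemma eval1U x (i : int) : eval1 << x *g i >> = x.
Proof. by rewrite /eval1 sum_msuppU mcoeffUU. Qed.

Lemma eval1_sum I (r : seq I) (F : I -> {malg g[int]}) :
  eval1 (\sum_(i <- r) F i) = \sum_(i <- r) eval1 (F i).
Proof. exact: (big_morph eval1 eval1D eval10). Qed.

Lemma eval1Z c (u : loop g) : eval1 (c *: u : loop g) = c *: eval1 u.
Proof.
rewrite [LHS](@eval1_wide (msupp u)).
  rewrite /eval1 scaler_sumr; apply: eq_bigr => i _; exact: loop_scaleE.
apply/fsubsetP => i; rewrite -!mcoeff_neq0; apply: contraNneq => ui0.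
by rewrite [X in X == 0]loop_scaleE ui0 scaler0.
Qed.

Variable (B : {symmetric g}).

Lemma affine_bracket_loop n (a b : affine g) :
  (affine_bracket B n a b).1 =
  \sum_(i <- msupp a.1) \sum_(j <- msupp b.1) << [lie a.1@_i, b.1@_j] *g i + j >>
  :> {malg g[int]}.
Proof.
rewrite /affine_bracket /= scaler0 addr0.
rewrite (big_morph fst (id1 := 0) (op1 := +%R)) //.
by apply: eq_bigr => i _; rewrite (big_morph fst (id1 := 0) (op1 := +%R)).
Qed.

(** For u the loop part of phi (x t^r) and d = M r, this is the linear form of the
statement that phi shifts the exponent of each rho-eigencomponent of x by its
eigenvalue. *)
Definition loop_lift (rho x : g) d (u : {malg g[int]}) : Prop :=
  eval1 u = x /\ forall i : int, [lie rho, u@_i] = (i - d)%:~R *: u@_i.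

Lemma loop_lift0 rho d : loop_lift rho 0 d 0.
Proof. by split=> [|i]; rewrite ?eval10 // mcoeff0 lie0r scaler0. Qed.

Lemma loop_lift_linear rho x y d c (u v : loop g) :
  loop_lift rho x d u -> loop_lift rho y d v ->
  loop_lift rho (c *: x + y) d (c *: u + v : loop g).
Proof.
move=> [ux uw] [vy vw]; split=> [|i]; first by rewrite eval1D eval1Z ux vy.
have -> : (c *: u + v : loop g)@_i = c *: u@_i + v@_i.
  by rewrite mcoeffD [X in X + _]loop_scaleE.
by rewrite lieDr lieZr uw vw scalerDr !scalerA mulrC.
Qed.

Lemma loop_lift_monomial rho x (i d : int) :
  [lie rho, x] = (i - d)%:~R *: x -> loop_lift rho x d << x *g i >>.
Proof.
move=> rx; split=> [|j]; first exact: eval1U.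
rewrite mcoeffU; case: eqP => [<-|_]; first by rewrite mulr1n.
by rewrite mulr0n lie0r scaler0.
Qed.

(** Evaluation at t = 1 is a Lie homomorphism, and on [u_i, v_j] both the exponents
and the eigenvalues of ad rho add up. *)
Lemma loop_lift_bracket rho x y n d e (a b : affine g) :
  loop_lift rho x d a.1 -> loop_lift rho y e b.1 ->
  loop_lift rho [lie x, y] (d + e) (affine_bracket B n a b).1.
Proof.
move=> [ax aw] [bY bw]; rewrite affine_bracket_loop; split=> [|l].
  rewrite eval1_sum -ax -bY [in RHS]/eval1 lie_suml; apply: eq_bigr => i _.
  rewrite eval1_sum /eval1 lie_sumr; apply: eq_bigr => j _; exact: eval1U.
rewrite raddf_sum lie_sumr scaler_sumr; apply: eq_bigr => i _ /=.
rewrite raddf_sum lie_sumr scaler_sumr; apply: eq_bigr => j _ /=.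
rewrite mcoeffU; case: eqP => [<-|_]; last by rewrite mulr0n lie0r scaler0.
rewrite mulr1n lie_leibniz aw bw lieZl lieZr -scalerDl -rmorphD.
by congr (_%:~R *: _); rewrite /=; ring.
Qed.

Lemma affine_bracket_monomiall n x (i : int) (c : k) (b : affine g) (l : int) :
  (affine_bracket B n (x \*t^ i + c *: affineC) b).1@_l = [lie x, b.1@_(l - i)].
Proof.
rewrite affine_bracket_loop /= scaler0 addr0 sum_msuppU ?mcoeffUU; last first.
  by move=> ->; rewrite big1 // => j _; rewrite lie0l monalgU0.
rewrite raddf_sum /= [in RHS](monalgE b.1) raddf_sum lie_sumr.
apply: eq_bigr => j _ /=; rewrite !mcoeffU.
have -> : (i + j == l) = (j == l - i) by rewrite [RHS]eq_sym subr_eq addrC eq_sym.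
by case: eqP => _; rewrite ?mulr1n ?mulr0n ?lie0r.
Qed.

(** The cocycle carries the degree of the left factor, which is 0. *)
Lemma affine_bracket_monomial0_center n x (c : k) (b : affine g) :
  (affine_bracket B n (x \*t^ 0 + c *: affineC) b).2 = 0.
Proof.
rewrite /affine_bracket /= scaler0 addr0.
rewrite (big_morph snd (id1 := 0) (op1 := +%R)) // big1 ?add0r; last first.
  by move=> i _; rewrite (big_morph snd (id1 := 0) (op1 := +%R)) // big1.
rewrite sum_msuppU ?mulr0 ?scale0r // => ->; by rewrite mulr0.
Qed.

End LoopEvaluation.
(** * Highest weight vectors *)

Section HighestWeight.
Variables (k : numFieldType) (g : finLieAlgType k).

(** The element rho serves to see that raising a weight by the psi_j, j >= 1, never
comes back to the same weight. The statement is symmetric under exchanging the E_j and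
the F_j, with -H, -psi and -c, so it covers g_[1] as well as g_[-1]. *)
Lemma affine_generator_acts (A M T : {vspace g}) (l : nat)
    (psi : 'I_l.+1 -> dual T) (H : 'I_l.+1 -> subvs_of T) (E F : 'I_l.+1 -> g)
    (rho : subvs_of T) (c : k) (a1 : 'I_l.+1 -> nat) :
  irreducible_module A M ->
  (forall j : 'I_l, E (lift ord0 j) \in A) ->
  (forall y, (forall j : 'I_l, [lie E (lift ord0 j), y] = 0
                              /\ [lie F (lift ord0 j), y] = 0) ->
     forall x, x \in A -> [lie x, y] = 0) ->
  E ord0 \in M -> E ord0 != 0 ->
  (forall j, weight_vector (psi j) (E j)) ->
  (forall j, [/\ [lie vsval (H j), E j] = 2 *: E j,
     [lie vsval (H j), F j] = - 2 *: F j & [lie E j, F j] = vsval (H j)]) ->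
  (forall j : 'I_l, psi (lift ord0 j) rho = c) -> c != 0 ->
  (forall j, (0 < a1 j)%N) -> \sum_j H j *+ a1 j = 0 ->
  exists2 y, y \in M & [lie E ord0, y] != 0.
Proof.
move=> irrM EA cent E0M E00 wE sl2 psir c0 a1pos a1H.
have [stM _ _] := irrM.
apply: contrapT => noact.
have {}noact y : y \in M -> [lie E ord0, y] = 0.
  by move=> yM; apply/eqP/negPn/negP => y0; apply: noact; exists y.
(* A highest weight vector exists: otherwise one could raise E_0 forever by
   suitable E_j, although each step adds c to the eigenvalue of ad rho. *)
have [be [y [yM y0 wy Ey]]] : exists (be : dual T) y,
    [/\ y \in M, y != 0, weight_vector be y
      & forall j : 'I_l, [lie E (lift ord0 j), y] = 0].
  apply: contrapT => nohw.
  have chain n : exists y, [/\ y \in M, y != 0 & exists2 be : dual T,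
      weight_vector be y & (be rho : k) = (psi ord0 rho : k) + c *+ n].
    elim: n => [|n [y [yM y0 [be wy ber]]]].
      by exists (E ord0); split=> //; exists (psi ord0); rewrite ?addr0.
    have [j Ejy] : exists j : 'I_l, [lie E (lift ord0 j), y] != 0.
      apply: contrapT => noj; apply: nohw; exists be, y; split=> // j.
      by apply/eqP/negPn/negP => Ejy; apply: noj; exists j.
    exists [lie E (lift ord0 j), y]; split=> //; first exact: stM.
    exists (psi (lift ord0 j) + be); first exact: weight_vector_lie.
    by rewrite add_lfunE /= psir ber mulrSr [LHS]addrC addrA.
  have [Y Yp] := choice chain.
  have [||i Yi0] := @eigenvector_sequence _ _ (lie_bracket (vsval rho))
      (fun n => (psi ord0 rho : k) + c *+ n) Y (lie_linearr _).
  - move=> i j /addrI /eqP; rewrite -!(mulr_natl c).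
    by move=> /eqP /(mulIf c0) /eqP; rewrite eqr_nat => /eqP.
  - by move=> i; have [_ _ [be wY <-]] := Yp i; apply: wY.
  - by have [_ /eqP] := Yp i.
have Eally (j : 'I_l.+1) : [lie E j, y] = 0.
  by case: (unliftP ord0 j) => [j'|] -> //; apply: noact.
have hw j : exists n : nat, (be (H j) : k) = n%:R /\ (n = 0%N -> [lie F j, y] = 0).
  have [he hf ef] := sl2 j.
  exact: (sl2_highest_weight he hf ef (wy (H j)) (Eally j) y0).
have [n np] := choice hw.
(* The weight of y vanishes on the relation between the H_j, whose coefficients
   are positive. *)
have n0 j : n j = 0%N.
  have : (\sum_j n j * a1 j)%N%:R = 0 :> k.
    rewrite natr_sum -[RHS](linear0 be) -a1H linear_sum; apply: eq_bigr => i _.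
    by rewrite linearMn natrM mulr_natr; have [<- _] := np i.
  move/eqP; rewrite pnatr_eq0 sum_nat_eq0 => /forallP /(_ j) /=.
  by rewrite muln_eq0 => /orP[/eqP //|]; rewrite -leqn0 leqNgt a1pos.
(* Hence y is invariant and M, being irreducible, is its line. *)
have Ay x : x \in A -> [lie x, y] = 0.
  by apply: cent => j; split=> //; have [_ ->] := np (lift ord0 j).
have [d dE] : exists d, E ord0 = d *: y.
  apply: (irreducible_module_closed irrM (P := fun z => exists d, z = d *: y)) => //.
  - by exists 0; rewrite scale0r.
  - by move=> e u v [d1 ->] [d2 ->]; exists (e * d1 + d2); rewrite scalerDl scalerA.
  - by move=> u v uA _ [e ->]; exists 0; rewrite lieZr Ay // scaler0 scale0r.
  - by exists y; split=> //; exists 1; rewrite scale1r.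
have [h0 _ _] := sl2 ord0.
have beH0 : (be (H ord0) : k) = 0 by have [-> _] := np ord0; rewrite n0.
move: h0; rewrite dE lieZr wy beH0 scale0r scaler0 -dE => /esym/eqP.
by rewrite scaler_eq0 pnatr_eq0 (negPf E00).
Qed.

End HighestWeight.

(** * Roots, coroots and labels *)

Section CartanData.
Variables (k : fieldType) (g : finLieAlgType k) (B : {symmetric g}).

Lemma form_sym x y : B x y = B y x.
Proof. by rewrite hermC expr0 mul1r. Qed.

Lemma form_oppl x y : B (- x) y = - B x y. Proof. exact: linearNl. Qed.

Lemma form_oppr x y : B x (- y) = - B x y. Proof. exact: linearNr. Qed.

Lemma form_scalel c x y : B (c *: x) y = c * B x y.
Proof. exact: linearZl_LR. Qed.

Lemma form_scaler c x y : B x (c *: y) = c * B x y.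
Proof. exact: linearZr_LR. Qed.

Lemma form_lie x y z : invariant_form B -> B [lie x, y] z = - B y [lie x, z].
Proof. by move=> invB; rewrite lieC form_oppl invB. Qed.

Lemma weight_pairing T (al be : dual T) x y : invariant_form B ->
  weight_vector al x -> weight_vector be y -> B x y != 0 -> be = - al.
Proof.
move=> invB wx wy Bxy; apply/eqP; rewrite -addr_eq0; apply/eqP/lfunP => h.
rewrite add_lfunE zero_lfunE; apply/eqP.
have := form_lie (vsval h) x y invB.
rewrite wx wy form_scalel form_scaler => /eqP.
rewrite -addr_eq0 -mulrDl mulf_eq0 (negPf Bxy) orbF.
by rewrite addrC.
Qed.

(** Since X spans the dual, all coordinates of x vanish. *)
Lemma dual_separates (T : {vspace g}) (x : subvs_of T) (X : seq (dual T)) :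
  basis_of fullv X -> (forall al, al \in X -> al x = 0) -> x = 0.
Proof.
move=> /andP[/eqP spanX _] Xx.
have all0 (al : dual T) : al x = 0.
  have : al \in <<in_tuple X>>%VS by rewrite spanX memvf.
  move=> /coord_span ->; rewrite sum_lfunE big1 // => i _.
  by rewrite scale_lfunE Xx ?scaler0 // mem_nth.
rewrite (coord_vbasis (memvf x)) big1 // => i _.
have := all0 (linfun (coord (vbasis fullv) i : subvs_of T -> k^o)).
by rewrite lfunE /= => ->; rewrite scale0r.
Qed.

Lemma free_codom_eq0 (V : vectType k) l (v : 'I_l -> V) (c : 'I_l -> k) :
  free (codom v) -> \sum_j c j *: v j = 0 -> forall j, c j = 0.
Proof.
move=> fv sc; have /freeP : free [tuple v i | i < l] by []; apply.
by rewrite -[RHS]sc; apply: eq_bigr => i _; rewrite -tnth_nth tnth_mktuple.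
Qed.

Lemma flat_eq0 (T : {vspace g}) (x : subvs_of T) :
  (T :&: orthov B T)%VS = 0%VS -> flat B T x = 0 -> x = 0.
Proof.
move=> T0 fx; apply/val_inj/eqP; rewrite -memv0 -T0 memv_cap (valP x).
apply/mem_orthovP => y yT; rewrite -(vsprojK yT).
by rewrite -(flatE B) fx zero_lfunE.
Qed.

(** The form identifies the coroot [x, y] with a multiple of the root: this is the
bridge between relations among the H_i and relations among the psi_i. *)
Lemma flat_coroot (T : {vspace g}) (al : dual T) (h : subvs_of T) x y :
  invariant_form B -> weight_vector al x -> vsval h = [lie x, y] ->
  flat B T h = B x y *: al.
Proof.
move=> invB wx hxy; apply/lfunP => u.
rewrite flatE hxy lieC form_oppl invB lieC form_oppr opprK wx form_scaler.
by rewrite scale_lfunE form_sym mulrC.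
Qed.

Variables (T : {vspace g}) (l : nat) (psi : 'I_l.+1 -> dual T).
Variables (H : 'I_l.+1 -> subvs_of T) (E F : 'I_l.+1 -> g) (a a1 : 'I_l.+1 -> nat).
Hypothesis invB : invariant_form B.
Hypothesis T0 : (T :&: orthov B T)%VS = 0%VS.
Hypothesis psi_basis : basis_of fullv (codom (fun j : 'I_l => psi (lift ord0 j))).
Hypothesis wE : forall i, weight_vector (psi i) (E i).
Hypothesis HEF : forall i, vsval (H i) = [lie E i, F i].
Hypothesis H_neq0 : forall i, H i != 0.

Local Notation b i := (B (E i) (F i)).

Lemma coroot_norm_neq0 i : b i != 0.
Proof.
apply: contraNneq (H_neq0 i) => bi0; apply/eqP/(flat_eq0 T0).
by rewrite (flat_coroot invB (wE i) (HEF i)) bi0 scale0r.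
Qed.

Lemma psi_separates (x : subvs_of T) :
  (forall j : 'I_l, psi (lift ord0 j) x = 0) -> x = 0.
Proof. by move=> px; apply: (dual_separates psi_basis) => _ /codomP[j ->]. Qed.

(** A bracket of elements of T lies in T and kills every weight vector, so every
simple root vanishes on it. *)
Lemma torus_abelian : subalgebra T -> (forall i, E i != 0) ->
  forall h h' : subvs_of T, [lie vsval h, vsval h'] = 0.
Proof.
move=> subT E0 h h'; have hh'T := subT _ _ (valP h) (valP h').
rewrite -[LHS](vsprojK hh'T) -[RHS](linear0 (@vsval k g T)); congr (vsval _).
apply: psi_separates => j; set z := vsproj T _; apply/eqP.
have : (psi (lift ord0 j) z : k) *: E (lift ord0 j) = 0.
  rewrite -(wE (lift ord0 j)) vsprojK //.
  have := lie_leibniz (vsval h) (vsval h') (E (lift ord0 j)).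
  rewrite !wE !lieZr !wE !scalerA mulrC => /esym/eqP.
  by rewrite -subr_eq0 addrK => /eqP.
by move/eqP; rewrite scaler_eq0 (negPf (E0 _)) orbF.
Qed.

Lemma corank_relation : (forall j, \sum_i (psi j (H i) : k) *+ a1 i = 0) ->
  \sum_i H i *+ a1 i = 0.
Proof.
move=> a1A; apply: psi_separates => j; rewrite linear_sum -[RHS](a1A (lift ord0 j)).
by apply: eq_bigr => i _; rewrite linearMn.
Qed.

(** The sum s is the image under flat of an element x of T; as s kills the
coroots, x is orthogonal to them, that is, killed by the simple roots. *)
Lemma root_relation : (forall i, \sum_j (psi j (H i) : k) *+ a j = 0) ->
  \sum_j psi j *+ a j = 0.
Proof.
move=> Aa; set s := \sum_j _.
pose x := \sum_j (b j)^-1 *: (H j *+ a j).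
have fx : flat B T x = s.
  rewrite linear_sum; apply: eq_bigr => j _.
  rewrite linearZ linearMn /= (flat_coroot invB (wE j) (HEF j)) -scalerMnr scalerA.
  by rewrite mulVf ?coroot_norm_neq0 // scale1r.
have -> : s = flat B T 0; last by rewrite linear0.
rewrite -fx; congr (flat B T _); apply: psi_separates => j; apply/eqP.
have : B (vsval (H (lift ord0 j))) (vsval x) = 0.
  rewrite form_sym -flatE fx sum_lfunE -[RHS](Aa (lift ord0 j)).
  by apply: eq_bigr => i _; rewrite -scaler_nat scale_lfunE; exact: mulr_natl.
rewrite -flatE (flat_coroot invB (wE _) (HEF _)) scale_lfunE => bx.
have /eqP : b (lift ord0 j) * (psi (lift ord0 j) x : k) = 0 := bx.
by rewrite mulf_eq0 (negPf (coroot_norm_neq0 _)).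
Qed.

(** The image under flat of the relation between the coroots is a relation between
the roots psi_0, ..., psi_l, hence a multiple of the one given by the a_i; the
factor is read off at i = 0, where a_0 = 1. *)
Lemma label_proportion : a ord0 = 1%N ->
  (forall i, \sum_j (psi j (H i) : k) *+ a j = 0) ->
  (forall j, \sum_i (psi j (H i) : k) *+ a1 i = 0) ->
  forall i, b i *+ a1 i = (b ord0 *+ a1 ord0) *+ a i.
Proof.
move=> a0 /root_relation; rewrite big_ord_recl a0 mulr1n => psi0.
move=> /corank_relation a1H.
have : \sum_i (b i *+ a1 i) *: psi i = 0.
  rewrite -[RHS](linear0 (flat B T)) -a1H linear_sum; apply: eq_bigr => i _.
  by rewrite linearMn /= (flat_coroot invB (wE i) (HEF i)) scalerMnl.
move/eqP: psi0; rewrite addr_eq0 => /eqP psi0; rewrite big_ord_recl psi0.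
rewrite scalerN scaler_sumr -sumrN -big_split /= => rel i.
case: (unliftP ord0 i) => [j|] -> /=; last by rewrite a0.
set c := b ord0 *+ a1 ord0 in rel *.
apply/eqP; rewrite -subr_eq0; apply/eqP; move: j.
apply: (free_codom_eq0 (basis_free psi_basis)).
rewrite -[RHS]rel; apply: eq_bigr => j _.
by rewrite scalerBl addrC -scalerMnr scalerMnl.
Qed.

(** The Cartan matrix of the psi_j, j >= 1, is invertible: a relation between its
rows is a relation between the coroots, hence by flat between the roots. The
element is sought among the combinations of the coroots because phi is known
on these. *)
Lemma height_coweight : exists c : 'I_l -> k, forall j : 'I_l,
  psi (lift ord0 j) (\sum_i c i *: H (lift ord0 i)) = 1.
Proof.
pose C := \matrix_(i < l, j < l) (psi (lift ord0 j) (H (lift ord0 i)) : k).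
have Cev (v : 'rV[k]_l) j :
    (v *m C) 0 j = psi (lift ord0 j) (\sum_i v 0 i *: H (lift ord0 i)).
  rewrite mxE linear_sum; apply: eq_bigr => i _.
  by rewrite mxE linearZ.
have Cunit : C \in unitmx.
  rewrite -row_free_unit -kermx_eq0; apply/rowV0P => v /sub_kermxP vC.
  have vH : \sum_i v 0 i *: H (lift ord0 i) = 0.
    by apply: psi_separates => j; rewrite -Cev vC mxE.
  apply/rowP => j; rewrite mxE; apply/eqP.
  have : \sum_i (v 0 i * b (lift ord0 i)) *: psi (lift ord0 i) = 0.
    rewrite -[RHS](linear0 (flat B T)) -vH linear_sum; apply: eq_bigr => i _.
    by rewrite linearZ /= (flat_coroot invB (wE _) (HEF _)) scalerA.
  move/(free_codom_eq0 (basis_free psi_basis))/(_ j)/eqP.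
  by rewrite mulf_eq0 (negPf (coroot_norm_neq0 _)) orbF.
pose v := const_mx 1 *m invmx C : 'rV_l.
exists (fun i => v 0 i) => j.
by rewrite -Cev /v mulmxKV // mxE.
Qed.

End CartanData.
(** * Isomorphisms of twisted affine algebras *)

Section TwistedElements.
Variables (k : fieldType) (g : finLieAlgType k).
Implicit Types (x y : g) (s : 'End(g)) (z : k).

Lemma monomial_linear c x y (i : int) :
  (c *: x + y) \*t^ i = c *: (x \*t^ i) + y \*t^ i.
Proof.
congr pair; last by rewrite /= scaler0 addr0.
apply/malgP => j; rewrite /= mcoeffD [X in _ = X + _]loop_scaleE !mcoeffU.
by rewrite mulrnDl scalerMnr.
Qed.

Lemma monomial0 (i : int) : (0 : g) \*t^ i = 0.
Proof. by congr pair; rewrite monalgU0. Qed.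

Lemma monomialZ c x (i : int) : (c *: x) \*t^ i = c *: (x \*t^ i).
Proof. by have := monomial_linear c x 0 i; rewrite !addr0 monomial0 addr0. Qed.

Lemma twisted_monomial s z (i : int) x :
  x \in eigenpiece s z i -> twisted s z (x \*t^ i).
Proof.
move=> xi j; rewrite mcoeffU; case: eqP => [<-|_]; first by rewrite mulr1n.
by rewrite mulr0n mem0v.
Qed.

Lemma twisted_center s z : twisted s z (affineC : affine g).
Proof. by move=> i; rewrite mcoeff0 mem0v. Qed.

Lemma twisted_linear s z c (u v : affine g) :
  twisted s z u -> twisted s z v -> twisted s z (c *: u + v).
Proof.
move=> tu tv i; rewrite /= mcoeffD.
by rewrite rpredD // [X in X \in _]loop_scaleE rpredZ.
Qed.

Lemma twisted0 s z : twisted s z (0 : affine g).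
Proof. by move=> i; rewrite mcoeff0 mem0v. Qed.

Lemma eigenpiece_congr s z (i j : int) :
  z ^ i = z ^ j -> eigenpiece s z i = eigenpiece s z j.
Proof. by rewrite /eigenpiece => ->. Qed.

(** This is why the three modules of degrees 0, 1 and -1 exhaust all degrees. *)
Lemma order_le3_power (K : nat) z (r : int) : K \in [:: 1; 2; 3]%N ->
  K.-primitive_root z -> [\/ z ^ r = z ^ 0, z ^ r = z ^ 1 | z ^ r = z ^ (-1)].
Proof.
move=> K123 /prim_expr_order zK.
have z0 : z != 0.
  apply/eqP => z0; move: zK; rewrite z0 expr0n.
  by move: K123; rewrite !inE => /or3P[] /eqP -> /= /esym/eqP; rewrite oner_eq0.
have zKz : z ^ K%:Z = 1 by exact: zK.
have red (q e : int) : r = q * K%:Z + e -> z ^ r = z ^ e.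
  by move=> ->; rewrite expfzDr // [q * _]mulrC -exprz_exp zKz exp1rz mul1r.
move: K123 red {zK zKz}; rewrite !inE => /or3P[] /eqP -> red.
- by constructor 1; apply: (red r); rewrite mulr1 addr0.
- have := divz_eq r 2; have : (0 <= r %% 2 < 2)%Z by lia.
  move: (r %/ 2)%Z (r %% 2)%Z => q e lte req.
  have : e = 0 \/ e = 1 by lia.
  by case=> e0; [constructor 1|constructor 2]; apply: (red q); rewrite req e0.
- have := divz_eq r 3; have : (0 <= r %% 3 < 3)%Z by lia.
  move: (r %/ 3)%Z (r %% 3)%Z => q e lte req.
  have : [\/ e = 0, e = 1 | e = 2].
    have : e = 0 \/ (e = 1 \/ e = 2) by lia.
    by case=> [|[]]; [constructor 1|constructor 2|constructor 3].
  case=> e0; [constructor 1|constructor 2|constructor 3];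
    [apply: (red q)|apply: (red q)|apply: (red (q + 1))]; rewrite req e0; lia.
Qed.

Variables (B : {symmetric g}) (s s' : 'End(g)) (z z' : k) (d d' : nat).
Variable phi : affine g -> affine g.
Hypothesis iso : affine_isomorphism B s z d s' z' d' phi.

Lemma iso_zero : phi 0 = 0.
Proof.
have := iso_linear iso (-1) (@twisted0 s z) (@twisted0 s z).
by rewrite scaler0 addr0 scaleN1r addNr.
Qed.

Lemma iso_scale c u : twisted s z u -> phi (c *: u) = c *: phi u.
Proof.
move=> tu; have := iso_linear iso c tu (@twisted0 s z).
by rewrite iso_zero !addr0.
Qed.

Lemma iso_add_center u c : phi affineC = affineC -> twisted s z u ->
  phi (u + c *: affineC) = phi u + c *: affineC.
Proof.
by move=> pC tu; rewrite addrC (iso_linear iso) ?pC 1?addrC //; apply: twisted_center.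
Qed.

Lemma iso_sum I (r : seq I) (c : I -> k) (F : I -> affine g) :
  (forall i, twisted s z (F i)) ->
  phi (\sum_(i <- r) c i *: F i) = \sum_(i <- r) c i *: phi (F i).
Proof.
move=> tF; suff [] : twisted s z (\sum_(i <- r) c i *: F i) /\
  phi (\sum_(i <- r) c i *: F i) = \sum_(i <- r) c i *: phi (F i) by [].
elim: r => [|i r [IHt IHp]]; first by rewrite !big_nil iso_zero; split=> //; apply: twisted0.
rewrite !big_cons (iso_linear iso) // IHp; split=> //; exact: twisted_linear.
Qed.

(** The rule for transporting brackets: each side has its own cocycle, and the
difference of the two is what moves central terms around. *)
Lemma iso_monomial_bracket (i j : int) x y : phi affineC = affineC ->
  automorphism s -> z != 0 -> x \in eigenpiece s z i -> y \in eigenpiece s z j ->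
  phi ([lie x, y] \*t^ (i + j)) + (B x y / d%:R * i%:~R * (i + j == 0)%:R) *: affineC
  = affine_bracket B d' (phi (x \*t^ i)) (phi (y \*t^ j)).
Proof.
move=> pC saut z0 xi yj.
rewrite -(iso_bracket iso) ?affine_bracket_monomial; try exact: twisted_monomial.
by rewrite iso_add_center //; apply/twisted_monomial/lie_eigenpiece.
Qed.

End TwistedElements.

(** * The isomorphism on root vectors *)

Section TwistedRealization.
Variables (k : numFieldType) (g : finLieAlgType k) (B : {symmetric g}).
Variables (K m : nat) (pi theta : 'End(g)) (eps omega : k).
Variable phi : affine g -> affine g.
Variables (T : {vspace g}) (l : nat) (psi : 'I_l.+1 -> dual T).
Variables (H : 'I_l.+1 -> subvs_of T) (E F : 'I_l.+1 -> g) (a a1 : 'I_l.+1 -> nat).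

Local Notation piece i := (eigenpiece pi eps i).
Local Notation deg i := ((i == ord0)%:Z).
Local Notation M := (\sum_j a j)%N.
Local Notation b i := (B (E i) (F i)).

Hypothesis iso : affine_isomorphism B pi eps K theta omega m phi.
Hypothesis invB : invariant_form B.
Hypothesis pi_aut : automorphism pi.
Hypothesis K123 : K \in [:: 1; 2; 3]%N.
Hypothesis eps_prim : K.-primitive_root eps.
Hypothesis irr0 : irreducible_module (piece 0) (piece 0).
Hypothesis irr1 : irreducible_module (piece 0) (piece 1).
Hypothesis irrN1 : irreducible_module (piece 0) (piece (-1)).
Hypothesis T_sub : (T <= piece 0)%VS.
Hypothesis T_abelian : forall h h' : subvs_of T, [lie vsval h, vsval h'] = 0.
Hypothesis T0 : (T :&: orthov B T)%VS = 0%VS.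
Hypothesis psi_basis : basis_of fullv (codom (fun j : 'I_l => psi (lift ord0 j))).
Hypothesis E_piece : forall i, E i \in piece (deg i).
Hypothesis F_piece : forall i, F i \in piece (- deg i).
Hypothesis wE : forall i, weight_vector (psi i) (E i).
Hypothesis wF : forall i, weight_vector (- psi i) (F i).
Hypothesis HEF : forall i, vsval (H i) = [lie E i, F i].
Hypothesis psiH : forall i, (psi i (H i) : k) = 2.
Hypothesis gen0 : generated_by (piece 0)
  (fun x => exists j : 'I_l, x = E (lift ord0 j) \/ x = F (lift ord0 j)).
Hypothesis a0 : a ord0 = 1%N.
Hypothesis a1_pos : forall i, (0 < a1 i)%N.
Hypothesis A_a : forall i, \sum_j (psi j (H i) : k) *+ a j = 0.
Hypothesis a1_A : forall j, \sum_i (psi j (H i) : k) *+ a1 i = 0.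
Hypothesis m_def : m = (K * M)%N.
Hypothesis phiE : forall i, phi (E i \*t^ deg i) = E i \*t^ 1.
Hypothesis phiF : forall i, phi (F i \*t^ (- deg i)) = F i \*t^ (-1).

Lemma order_gt0 : (0 < K)%N.
Proof. exact: prim_order_gt0 eps_prim. Qed.

Lemma label_sum_gt0 : (0 < M)%N.
Proof. by rewrite (bigD1 ord0) //= a0. Qed.

Lemma eps_neq0 : eps != 0.
Proof.
have := prim_expr_order eps_prim; apply: contra_eqN => /eqP ->.
by rewrite expr0n eqn0Ngt order_gt0 eq_sym oner_eq0.
Qed.

Lemma coroot_neq0 i : H i != 0.
Proof.
by apply/eqP => Hi0; have /eqP := psiH i; rewrite Hi0 linear0 eq_sym pnatr_eq0.
Qed.

Lemma coroot_piece i : vsval (H i) \in piece 0.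
Proof. exact: (subvP T_sub) (valP _). Qed.

Lemma sl2_triple i : [/\ [lie vsval (H i), E i] = 2 *: E i,
  [lie vsval (H i), F i] = - 2 *: F i & [lie E i, F i] = vsval (H i)].
Proof. by rewrite wE (weight_vectorN _ (wF i)) psiH HEF. Qed.

Lemma label_identity i : b i *+ a1 i = b ord0 *+ a1 ord0 *+ a i.
Proof. exact: (label_proportion invB T0 psi_basis wE HEF coroot_neq0). Qed.

Lemma phi_coroot i :
  phi (vsval (H i) \*t^ 0) + (b i / K%:R * (deg i)%:~R) *: phi affineC
  = vsval (H i) \*t^ 0 + (b i / m%:R) *: affineC.
Proof.
have := iso_bracket iso (twisted_monomial (E_piece i)) (twisted_monomial (F_piece i)).
rewrite phiE phiF !affine_bracket_monomial !subrr eqxx !mulr1 -HEF => <-.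
rewrite [in RHS]addrC (iso_linear iso) 1?addrC //; first exact: twisted_center.
exact/twisted_monomial/coroot_piece.
Qed.

(** Apply phi to the relation between the coroots, with [phi_coroot] for each of
them, and put q = a^1_0 b_0. On the left only i = 0 contributes, namely q / K
times phi C; on the right the proportionality of labels turns the sum of the a^1_i b_i / m into
q / m times the sum of the a_i, which is again q / K. *)
Lemma phi_center : phi affineC = affineC.
Proof.
have K0 : K%:R != 0 :> k by rewrite pnatr_eq0 -lt0n order_gt0.
have M0 : M%:R != 0 :> k by rewrite pnatr_eq0 -lt0n label_sum_gt0.
have relation (f : subvs_of T -> affine g) :
    (forall c x y, f (c *: x + y) = c *: f x + f y) ->
    \sum_i (a1 i)%:R *: f (H i) = 0.
  move=> flin; have f0 : f 0 = 0.
    by have := flin (-1) 0 0; rewrite scaler0 addr0 scaleN1r addNr.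
  have fD : {morph f : x y / x + y} by move=> x y; rewrite -[x in LHS]scale1r flin scale1r.
  rewrite -[RHS]f0 -(corank_relation psi_basis a1_A) (big_morph f fD f0).
  by apply: eq_bigr => i _; rewrite -[in RHS]scaler_nat -[X in _ = f X]addr0 flin f0 addr0.
pose q := b ord0 *+ a1 ord0.
have q0 : q != 0 by rewrite mulrn_eq0 negb_or -lt0n a1_pos (coroot_norm_neq0 invB T0 wE HEF coroot_neq0).
have phiH : \sum_i (a1 i)%:R *: phi (vsval (H i) \*t^ 0) = 0.
  apply: (relation (fun h => phi (vsval h \*t^ 0))) => c x y.
  rewrite linearP monomial_linear (iso_linear iso) //.
    exact/twisted_monomial/(subvP T_sub)/valP.
  exact/twisted_monomial/(subvP T_sub)/valP.
have monH : \sum_i (a1 i)%:R *: (vsval (H i) \*t^ 0) = 0.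
  by apply: (relation (fun h => vsval h \*t^ 0)) => c x y; rewrite linearP monomial_linear.
have lhs : \sum_i (a1 i)%:R *: (phi (vsval (H i) \*t^ 0)
    + (b i / K%:R * (deg i)%:~R) *: phi affineC) = (q / K%:R) *: phi affineC.
  under eq_bigr do rewrite scalerDr scalerA.
  rewrite big_split /= phiH add0r -scaler_suml; congr (_ *: _).
  rewrite big_ord_recl big1 ?addr0 => [|j _]; first by rewrite /= mulr1 mulrA mulr_natl.
  by rewrite /= !mulr0.
have rhs : \sum_i (a1 i)%:R *: (vsval (H i) \*t^ 0 + (b i / m%:R) *: affineC)
    = (q / K%:R) *: affineC.
  under eq_bigr do rewrite scalerDr scalerA.
  rewrite big_split /= monH add0r -scaler_suml; congr (_ *: _).
  under eq_bigr do rewrite mulrA mulr_natl label_identity -/q -[q *+ _]mulr_natr -mulrA.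
  by rewrite -mulr_sumr -mulr_suml -natr_sum m_def natrM; field; rewrite K0.
apply: (scalerI (mulf_neq0 q0 (invr_neq0 K0))); rewrite -lhs -rhs.
by apply: eq_bigr => i _; rewrite phi_coroot.
Qed.

Lemma height_element : exists rho : subvs_of T,
  (forall j : 'I_l, (psi (lift ord0 j) rho : k) = 1) /\
  exists c, phi (vsval rho \*t^ 0) = vsval rho \*t^ 0 + c *: affineC.
Proof.
have [c cP] := height_coweight invB T0 psi_basis wE HEF coroot_neq0.
exists (\sum_i c i *: H (lift ord0 i)); split; first exact: cP.
have phiH (i : 'I_l) : phi (vsval (H (lift ord0 i)) \*t^ 0) =
    vsval (H (lift ord0 i)) \*t^ 0 + (b (lift ord0 i) / m%:R) *: affineC.
  by rewrite -phi_coroot /= mulr0 scale0r addr0.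
exists (\sum_i c i * (b (lift ord0 i) / m%:R)).
have mon (n : nat) (f : 'I_n -> k) (h : 'I_n -> subvs_of T) :
    vsval (\sum_i f i *: h i) \*t^ 0 = \sum_i f i *: (vsval (h i) \*t^ 0).
  rewrite linear_sum /=; elim: n f h => [|n IHn] f h.
    by rewrite !big_ord0 monomial0.
  by rewrite !big_ord_recl /= monomial_linear IHn.
rewrite mon (iso_sum iso) => [|i]; last exact/twisted_monomial/coroot_piece.
rewrite scaler_suml -big_split; apply: eq_bigr => i _.
by rewrite phiH scalerDr scalerA.
Qed.

Section Height.
Variables (rho : subvs_of T) (crho : k).
Hypothesis psi_rho : forall j : 'I_l, (psi (lift ord0 j) rho : k) = 1.
Hypothesis phi_rho : phi (vsval rho \*t^ 0) = vsval rho \*t^ 0 + crho *: affineC.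

(** Evaluate at rho the relation between the psi_j, in which a_0 = 1. *)
Lemma psi0_rho : (psi ord0 rho : k) = 1 - M%:R.
Proof.
have := root_relation invB T0 psi_basis wE HEF coroot_neq0 A_a.
move/lfunP/(_ rho); rewrite sum_lfunE zero_lfunE big_ord_recl a0 mulr1n.
have -> : \sum_(i < l) (psi (lift ord0 i) *+ a (lift ord0 i)) rho
    = \sum_(i < l) (a (lift ord0 i))%:R :> k.
  apply: eq_bigr => i _; rewrite -scaler_nat scale_lfunE.
  by rewrite -[RHS]mulr1 -(psi_rho i).
move/eqP; rewrite addr_eq0 => /eqP ->.
by rewrite natr_sum big_ord_recl a0 opprD addrA subrr add0r.
Qed.

Lemma psi_rho_all i : (psi i rho : k) = (1 - M%:Z * deg i)%:~R.
Proof.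
case: (unliftP ord0 i) => [j|] ->; first by rewrite psi_rho /= mulr0 subr0.
by rewrite psi0_rho /= mulr1 rmorphB.
Qed.

Definition lifted (r : int) (x : g) :=
  loop_lift (vsval rho) x (M%:Z * r) (phi (x \*t^ r)).1.

Lemma lifted_linear r c x y : x \in piece r -> y \in piece r ->
  lifted r x -> lifted r y -> lifted r (c *: x + y).
Proof.
move=> xr yr lx ly; rewrite /lifted monomial_linear (iso_linear iso).
- exact: loop_lift_linear.
- exact: twisted_monomial.
- exact: twisted_monomial.
Qed.

Lemma lifted_lie r r' x y : x \in piece r -> y \in piece r' ->
  lifted r x -> lifted r' y -> lifted (r + r') [lie x, y].
Proof.
move=> xr yr lx ly; have := loop_lift_bracket B m lx ly.
rewrite -(iso_monomial_bracket iso phi_center pi_aut eps_neq0 xr yr).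
by rewrite /lifted mulrDr /= scaler0 addr0.
Qed.

Lemma lifted0 r : lifted r 0.
Proof. by rewrite /lifted monomial0 (iso_zero iso); apply: loop_lift0. Qed.

Lemma lifted_E i : lifted (deg i) (E i).
Proof.
by rewrite /lifted phiE; apply: loop_lift_monomial; rewrite wE psi_rho_all.
Qed.

Lemma lifted_F i : lifted (- deg i) (F i).
Proof.
rewrite /lifted phiF; apply: loop_lift_monomial.
rewrite (weight_vectorN _ (wF i)) psi_rho_all -rmorphN; congr (_%:~R *: _).
by rewrite mulrN; ring.
Qed.

(** The E_j and F_j with j >= 1 generate g_[0]. *)
Lemma lifted_piece0 x : x \in piece 0 -> lifted 0 x.
Proof.
move=> x0; suff [] : x \in piece 0 /\ lifted 0 x by [].
apply: (generated_by_closed gen0 (P := fun y => y \in piece 0 /\ lifted 0 y)) => //.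
- by split; [exact: mem0v | exact: lifted0].
- move=> c u v [u0 lu] [v0 lv]; split; first by rewrite rpredD ?rpredZ.
  exact: lifted_linear.
- move=> u v [u0 lu] [v0 lv]; rewrite -(addr0 (0 : int)).
  by split; [exact: lie_eigenpiece pi_aut eps_neq0 _ _ | exact: lifted_lie].
- by move=> _ [j [] ->]; split;
    [exact: E_piece | exact: lifted_E | exact: F_piece | exact: lifted_F].
Qed.

Lemma piece_irreducible r : irreducible_module (piece 0) (piece r).
Proof.
by case: (order_le3_power r K123 eps_prim) => er; rewrite (eigenpiece_congr pi er).
Qed.

Lemma E_neq0 i : E i != 0.
Proof.
apply: contraNneq (coroot_neq0 i) => Ei; apply/eqP/val_inj.
by rewrite /= HEF Ei lie0l.
Qed.

Lemma F_neq0 i : F i != 0.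
Proof.
apply: contraNneq (coroot_neq0 i) => Fi; apply/eqP/val_inj.
by rewrite /= HEF Fi lie0r.
Qed.

Lemma vcoroot_neq0 i : vsval (H i) != 0.
Proof. by rewrite (inj_eq val_inj (H i) 0) coroot_neq0. Qed.

Lemma centralize_gen0 y :
  (forall j : 'I_l, [lie E (lift ord0 j), y] = 0 /\ [lie F (lift ord0 j), y] = 0) ->
  forall x, x \in piece 0 -> [lie x, y] = 0.
Proof.
move=> cy; apply: (generated_by_centralize gen0) => _ [j [] ->].
  by have [] := cy j.
by have [] := cy j.
Qed.

(** For r = 0, 1, -1 modulo K use H_0, [affine_generator_acts] and F_0. *)
Lemma E0_acts r : exists2 y, y \in piece r & [lie E ord0, y] != 0.
Proof.
case: (order_le3_power r K123 eps_prim) => er; rewrite (eigenpiece_congr pi er).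
- exists (vsval (H ord0)); first exact: coroot_piece.
  have [h0 _ _] := sl2_triple ord0.
  by rewrite lieC h0 oppr_eq0 scaler_eq0 pnatr_eq0 E_neq0.
- apply: (affine_generator_acts irr1 (F := F) (psi := psi) (H := H) (rho := rho)
    (c := 1) (a1 := a1)) => //.
  + exact: centralize_gen0.
  + exact: E_neq0.
  + exact: sl2_triple.
  + exact: oner_neq0.
  + exact: corank_relation psi_basis a1_A.
- exists (F ord0); first exact: (F_piece ord0).
  by rewrite -HEF vcoroot_neq0.
Qed.

Lemma F0_acts r : exists2 y, y \in piece r & [lie F ord0, y] != 0.
Proof.
case: (order_le3_power r K123 eps_prim) => er; rewrite (eigenpiece_congr pi er).
- exists (vsval (H ord0)); first exact: coroot_piece.
  have [_ h0 _] := sl2_triple ord0.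
  by rewrite lieC h0 oppr_eq0 scaler_eq0 oppr_eq0 pnatr_eq0 F_neq0.
- exists (E ord0); first exact: (E_piece ord0).
  by rewrite lieC -HEF oppr_eq0 vcoroot_neq0.
- apply: (affine_generator_acts irrN1 (E := F) (F := E) (psi := fun j => - psi j)
    (H := fun j => - H j) (rho := rho) (c := -1) (a1 := a1)) => //.
  + by move=> y cy; apply: centralize_gen0 => j; have [] := cy j.
  + exact: F_neq0.
  + move=> j; have [he hf ef] := sl2_triple j.
    have -> : vsval (- H j) = - vsval (H j) by rewrite linearN.
    by rewrite !lieNl he hf lieC ef !scaleNr opprK.
  + by move=> j; rewrite opp_lfunE psi_rho.
  + by rewrite oppr_eq0 oner_neq0.
  + rewrite -[RHS]oppr0 -[in RHS](corank_relation psi_basis a1_A) -sumrN.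
    by apply: eq_bigr => j _; rewrite mulNrn.
Qed.

(** The lifted vectors of degree s form a submodule, which contains the nonzero
element [x, y]. *)
Lemma lifted_step r e s x : s = e + r -> x \in piece e -> lifted e x ->
  (exists2 y, y \in piece r & [lie x, y] != 0) ->
  (forall y, y \in piece r -> lifted r y) ->
  forall y, y \in piece s -> lifted s y.
Proof.
move=> sE xe lx [y0 y0r xy0] lr y ys.
suff [] : y \in piece s /\ lifted s y by [].
apply: (irreducible_module_closed (piece_irreducible s)
  (P := fun z => z \in piece s /\ lifted s z)) ys.
- by split; [exact: mem0v | exact: lifted0].
- move=> c u v [us lu] [vs lv]; split; first by rewrite rpredD ?rpredZ.
  exact: lifted_linear.
- move=> u v u0 _ [vs lv].
  have := lie_eigenpiece pi_aut eps_neq0 u0 vs.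
  have := lifted_lie u0 vs (lifted_piece0 u0) lv.
  by rewrite add0r; split.
- have := lie_eigenpiece pi_aut eps_neq0 xe y0r.
  have := lifted_lie xe y0r lx (lr _ y0r).
  by rewrite -sE => l01 p01; exists [lie x, y0].
Qed.

(** Induction upwards with E_0 in degree 1 and downwards with F_0 in degree -1. *)
Lemma lifted_all r x : x \in piece r -> lifted r x.
Proof.
have pos (n : nat) y : y \in piece n%:Z -> lifted n%:Z y.
  elim: n y => [|n IHn]; first exact: lifted_piece0.
  exact: (lifted_step (PoszD 1 n) (E_piece ord0) (lifted_E ord0) (E0_acts _)).
have neg (n : nat) y : y \in piece (- n%:Z) -> lifted (- n%:Z) y.
  elim: n y => [|n IHn]; first by rewrite oppr0; exact: lifted_piece0.
  have sE : - n.+1%:Z = - 1 + - n%:Z by rewrite -opprD -PoszD.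
  exact: (lifted_step sE (F_piece ord0) (lifted_F ord0) (F0_acts _)).
by case: (intP r) => [|n|n]; [exact: lifted_piece0 | exact: pos | exact: neg].
Qed.

(** The eigenvalues n and i - d of ad rho on u_i agree only for i = n + d; then the
single coefficient is recovered by evaluation at t = 1. *)
Lemma loop_lift_eigen (x : g) (d n : int) (u : {malg g[int]}) :
  loop_lift (vsval rho) x d u ->
  (forall i, [lie vsval rho, u@_i] = n%:~R *: u@_i) -> u = << x *g n + d >>.
Proof.
move=> [ux uw] un.
have u0 i : i != n + d -> u@_i = 0.
  move=> inD; have /eqP := uw i; rewrite un -subr_eq0 -scalerBl -rmorphB.
  rewrite scaler_eq0 intr_eq0 => /orP[|/eqP //].
  by rewrite subr_eq0 -subr_eq opprK eq_sym (negPf inD).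
have uE : u = << u@_(n + d) *g n + d >>.
  apply/malgP => i; rewrite mcoeffU; case: eqP => [->|/eqP]; first by rewrite mulr1n.
  by rewrite eq_sym => /u0 ->.
by rewrite {1}uE; congr << _ *g _ >>; rewrite -ux {2}uE eval1U.
Qed.

(** Apply phi to the bracket of rho, in degree 0, with x t^r: the cocycle vanishes
there, and phi(rho) differs from rho by a central element. *)
Lemma phi_rho_bracket (r : int) (x : g) (c : k) : x \in piece r ->
  [lie vsval rho, x] = c *: x ->
  forall i, [lie vsval rho, (phi (x \*t^ r)).1@_i] = c *: (phi (x \*t^ r)).1@_i.
Proof.
move=> xr rx i.
have rho0 : vsval rho \in piece 0 by exact: (subvP T_sub) (valP _).
have := iso_monomial_bracket iso phi_center pi_aut eps_neq0 rho0 xr.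
rewrite mulr0 mul0r scale0r addr0 add0r rx phi_rho monomialZ.
rewrite (iso_scale iso) => [eqb|]; last exact: twisted_monomial.
have := congr1 (fun v : affine g => v.1@_i) eqb.
by rewrite affine_bracket_monomiall subr0 => <-; rewrite [LHS]loop_scaleE.
Qed.

(** An element of t has ad rho-eigenvalue 0, so only the exponent 0 survives. *)
Lemma phi_torus (h : subvs_of T) : exists c : k,
  phi (vsval h \*t^ 0) = vsval h \*t^ 0 + c *: affineC.
Proof.
have h0 : vsval h \in piece 0 by exact: (subvP T_sub) (valP _).
have ph : (phi (vsval h \*t^ 0)).1 = << vsval h *g 0 >>.
  have := loop_lift_eigen (lifted_piece0 h0) (n := 0).
  rewrite mulr0 addr0; apply; apply: phi_rho_bracket => //.
  by rewrite T_abelian scale0r.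
exists (phi (vsval h \*t^ 0)).2; rewrite [LHS]surjective_pairing ph.
by congr pair; rewrite /= ?scaler0 ?addr0 ?add0r // [RHS]mulr1.
Qed.

Lemma phi_real_root (al : dual T) (r : int) (x : g) :
  real_root_vector pi eps al r x ->
  exists2 n : int, (al rho : k) = n%:~R & phi (x \*t^ r) = x \*t^ (n + M%:Z * r).
Proof.
move=> [xr x0 wx al0]; have lx := lifted_all xr.
have urho := phi_rho_bracket xr (wx rho).
have [i ui0] : exists i, (phi (x \*t^ r)).1@_i != 0.
  apply: contrapT => noi; case/eqP: x0; have [<- _] := lx; rewrite /eval1 big1 // => i _.
  by apply/eqP/negPn/negP => ui0; apply: noi; exists i.
have aln : (al rho : k) = (i - M%:Z * r)%:~R.
  have [_ /(_ i)] := lx; rewrite urho => /eqP; rewrite -subr_eq0 -scalerBl.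
  by rewrite scaler_eq0 (negPf ui0) orbF subr_eq0 => /eqP.
exists (i - M%:Z * r) => //; set n := i - _ in aln *.
have ph : (phi (x \*t^ r)).1 = << x *g n + M%:Z * r >>.
  by apply: loop_lift_eigen => // j; rewrite urho aln.
(* The image of x t^r has no central term: it is a multiple of a bracket with
   phi(h), which has degree 0. *)
have [h alh] : exists h, (al h : k) != 0.
  apply: contrapT => noh; case/eqP: al0; apply/lfunP => h; rewrite zero_lfunE.
  by apply/eqP/negPn/negP => alh; apply: noh; exists h.
have [c phih] := phi_torus h.
have h0 : vsval h \in piece 0 by exact: (subvP T_sub) (valP _).
have := iso_monomial_bracket iso phi_center pi_aut eps_neq0 h0 xr.
rewrite mulr0 mul0r scale0r addr0 add0r wx phih monomialZ.
rewrite (iso_scale iso) => [eqb|]; last exact: twisted_monomial.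
have := congr1 snd eqb; rewrite affine_bracket_monomial0_center => /eqP.
have -> : (((al h : k) *: phi (x \*t^ r)).2 == 0)
    = ((al h : k) * (phi (x \*t^ r)).2 == 0) by [].
rewrite mulf_eq0 (negPf alh) /= => /eqP ph2.
by rewrite [LHS]surjective_pairing ph ph2.
Qed.

Variable N : dual T -> int.
Hypothesis N_rho : forall (al : dual T) (n : int), (al rho : k) = n%:~R -> N al = n.

Lemma phi_real_root_height (al : dual T) (r : int) (x : g) :
  real_root_vector pi eps al r x -> phi (x \*t^ r) = x \*t^ (N al + M%:Z * r).
Proof. by move=> /phi_real_root[n /N_rho -> ->]. Qed.

Lemma height_opposite (al be : dual T) (r s : int) (x y : g) :
  real_root_vector pi eps al r x -> real_root_vector pi eps be s y ->
  be = - al -> N al + N be = 0.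
Proof.
move=> /phi_real_root[n aln _] _ ->; rewrite (N_rho aln) (N_rho (n := - n)) ?subrr //.
by rewrite opp_lfunE aln rmorphN.
Qed.

Lemma phi_root_bracket (al be : dual T) (r s : int) (x y : g) :
  real_root_vector pi eps al r x -> real_root_vector pi eps be s y ->
  phi ([lie x, y] \*t^ (r + s))
    + (B x y / K%:R * r%:~R * (r + s == 0)%:R) *: affineC
  = [lie x, y] \*t^ ((r + s) * M%:Z + N al + N be)
    + (B x y / m%:R * (N al + M%:Z * r)%:~R
       * ((r + s) * M%:Z + N al + N be == 0)%:R) *: affineC.
Proof.
move=> rx ry; have [xr _ _ _] := rx; have [ys _ _ _] := ry.
rewrite (iso_monomial_bracket iso phi_center pi_aut eps_neq0 xr ys).
rewrite (phi_real_root_height rx) (phi_real_root_height ry) affine_bracket_monomial.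
suff -> : N al + M%:Z * r + (N be + M%:Z * s) = (r + s) * M%:Z + N al + N be by [].
ring.
Qed.

(** Expand the bracket of x t^s and y t^(r - s). On the source side the cocycle gives
B x y / K times s, on the target side B x y / m times N al + M s; as M / m = 1 / K,
the difference is B x y times N al / m. *)
Lemma phi_coroot_vector (al : dual T) (s r : int) (x y : g) :
  real_root_vector pi eps al s x -> y \in piece s -> weight_vector (- al) y ->
  [lie x, y] \in piece r ->
  phi ([lie x, y] \*t^ r) = [lie x, y] \*t^ (M%:Z * r)
    + (B x y * ((N al)%:~R / m%:R) * (r == 0)%:R) *: affineC.
Proof.
move=> rx ys wy xyr; have [xs x0 wx al0] := rx.
(* If [x, y] = 0 the degree r is unconstrained, but then B x y = 0 because
   B [x, y] h = al(h) B x y up to sign. *)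
have [xy0|xy0] := eqVneq [lie x, y] 0.
  suff -> : B x y = 0 by rewrite !mul0r scale0r addr0 xy0 !monomial0 (iso_zero iso).
  apply/eqP/negPn/negP => Bxy; case/eqP: al0; apply/lfunP => h; rewrite zero_lfunE.
  apply/eqP; have := invB x y (vsval h); rewrite xy0 lieC (weight_vectorN _ wy).
  have -> : B 0 (vsval h) = 0 by rewrite -(scale0r (0 : g)) form_scalel mul0r.
  rewrite scaleNr opprK form_scaler.
  by move/esym/eqP; rewrite mulf_eq0 (negPf Bxy) orbF.
(* A nonzero bracket has only one degree modulo K, hence y also lies in degree
   r - s. *)
have erss : eps ^ r = eps ^ (s + s).
  have := lie_eigenpiece pi_aut eps_neq0 xs ys; move: xyr.
  rewrite !mem_eigenpiece => /eqP -> /eqP/eqP; rewrite -subr_eq0 -scalerBl.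
  by rewrite scaler_eq0 (negPf xy0) orbF subr_eq0 => /eqP.
have ers : eps ^ (r - s) = eps ^ s.
  by rewrite expfzDr ?eps_neq0 // erss -expfzDr ?eps_neq0 // addrK.
have y0 : y != 0 by apply: contraNneq xy0 => ->; rewrite lie0r.
have ry : real_root_vector pi eps (- al) (r - s) y.
  by split; rewrite ?(eigenpiece_congr pi ers) ?oppr_eq0.
have := phi_root_bracket rx ry.
have Nopp := height_opposite rx ry erefl.
rewrite -addrA Nopp addr0 [s + _]addrC subrK.
have M0 : M%:R != 0 :> k by rewrite pnatr_eq0 -lt0n label_sum_gt0.
have K0 : K%:R != 0 :> k by rewrite pnatr_eq0 -lt0n order_gt0.
have -> : (r * M%:Z == 0) = (r == 0).
  by rewrite mulf_eq0 orbC eqz_nat eqn0Ngt label_sum_gt0.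
move/(canRL (addrK _)) ->; rewrite -addrA -scalerBl [r * _]mulrC.
congr (_ + _); congr (_ *: _); rewrite -mulrBl; congr (_ * _).
by rewrite m_def natrM rmorphD rmorphM /=; field; rewrite M0 K0.
Qed.

End Height.
End TwistedRealization.
(** * The Chevalley involution *)

Section Chevalley.
Variables (k : fieldType) (g : finLieAlgType k).

(** H_j = [E_j, F_j] is generated by the others. *)
Lemma canonical_generators_EF (A T : {vspace g}) l (psi : 'I_l -> dual T)
    (H : 'I_l -> subvs_of T) (E F : 'I_l -> g) :
  canonical_generators A psi H E F ->
  generated_by A (fun x => exists j, x = E j \/ x = F j).
Proof.
move=> [_ mem EF _ [subA _ genA]]; split=> // [_ [j [] ->]|U subU SU].
- by have [] := mem j.
- by have [] := mem j.
have EU j : E j \in U by apply: SU; exists j; left.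
have FU j : F j \in U by apply: SU; exists j; right.
apply: genA => // _ [j [] ->] //.
by have := EF j j; rewrite eqxx => <-; apply: subU.
Qed.

Variables (h : {vspace g}) (n : nat) (alpha : 'I_n -> dual h).
Variables (hh : 'I_n -> subvs_of h) (e f : 'I_n -> g) (w : 'End(g)).
Hypothesis g_simple : simple_algebra (fullv : {vspace g}).
Hypothesis hef_canonical : canonical_generators fullv alpha hh e f.
Hypothesis w_chevalley : chevalley_involution hh e f w.

(** Applying w to [x, e_i] and [x, f_i] shows that w x + x commutes with all the
generators, so it is central, so it is 0. *)
Lemma chevalley_cartan x : x \in h -> w x = - x.
Proof.
move=> xh; rewrite -(vsprojK xh); set u := vsproj h x.
have [[_ wM] wef] := w_chevalley.
apply/eqP; rewrite -addr_eq0; apply/eqP/(simple_algebra_center0 g_simple) => y.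
apply: (generated_by_centralize (canonical_generators_EF hef_canonical)) (memvf y).
have [_ wt _ _ _] := hef_canonical.
move=> _ [i [] ->]; have [we wf _] := wef i; have [_ _ wte wtf] := wt i.
  rewrite lieC lieDl wte; have := congr1 w (weight_vectorN u wtf).
  rewrite wM wf lieNr linearZ /= wf scaleNr scalerN opprK => /eqP.
  by rewrite eqr_oppLR => /eqP ->; rewrite addNr oppr0.
rewrite lieC lieDl (weight_vectorN _ wtf); have := congr1 w (wte u).
rewrite wM we lieNr linearZ /= we scalerN => /oppr_inj ->.
by rewrite scaleNr addrN oppr0.
Qed.

Lemma chevalley_diagram_commute s x :
  diagram_automorphism alpha hh e f s -> w (s x) = s (w x).
Proof.
move=> [[_ sM] [p [_ se sf]]]; have [[_ wM] wef] := w_chevalley.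
apply: (generated_by_closed (canonical_generators_EF hef_canonical)
  (P := fun y => w (s y) = s (w y))) (memvf x).
- by rewrite !linear0.
- by move=> c u v wu wv; rewrite !linearP /= wu wv.
- by move=> u v wu wv; rewrite sM !wM sM wu wv.
move=> _ [i [] ->]; have [we wf _] := wef i.
  by rewrite we se linearN /= sf; have [-> _ _] := wef (p i).
by rewrite wf sf linearN /= se; have [_ -> _] := wef (p i).
Qed.

Lemma chevalley_weight_vector (t : {vspace g}) (al : dual t) x :
  (t <= h)%VS -> weight_vector al x -> weight_vector (- al) (w x).
Proof.
move=> th wx u; have [[_ wM] _] := w_chevalley.
rewrite opp_lfunE scaleNr -[RHS]opprK; apply: canRL opprK _.
rewrite -lieNl -chevalley_cartan ?(subvP th) ?(valP u) // -wM wx linearZ /=.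
by rewrite opprK.
Qed.

Lemma chevalley_eigenpiece s z (i : int) x :
  diagram_automorphism alpha hh e f s ->
  x \in eigenpiece s z i -> w x \in eigenpiece s z i.
Proof.
move=> s_diag; rewrite !mem_eigenpiece -chevalley_diagram_commute // => /eqP ->.
by rewrite linearZ.
Qed.

End Chevalley.

(** * The theorem *)

Theorem mainTheorem4
  (R : realType) (g : finLieAlgType R[i]) (B : {symmetric g})
  (g_simple : simple_algebra (fullv : {vspace g}))
  (B_nondegenerate : nondegenerate B) (B_invariant : invariant_form B)
  (* Cartan subalgebra, simple roots and canonical generators of g *)
  (h : {vspace g}) (n : nat) (alpha : 'I_n -> dual h)
  (hh : 'I_n -> subvs_of h) (e f : 'I_n -> g)
  (h_cartan : cartan_subalgebra fullv h)
  (hef_canonical : canonical_generators fullv alpha hh e f)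
  (* the diagram automorphism and its grading *)
  (K : nat) (pi : 'End(g)) (eps : R[i])
  (K123 : K \in [:: 1; 2; 3]%N)
  (pi_diagram : diagram_automorphism alpha hh e f pi)
  (pi_order : has_order pi K) (eps_prim : K.-primitive_root eps)
  (g0_simple : simple_algebra (eigenpiece pi eps 0))
  (g1_irr : irreducible_module (eigenpiece pi eps 0) (eigenpiece pi eps 1))
  (gN1_irr : irreducible_module (eigenpiece pi eps 0) (eigenpiece pi eps (-1)))
  (g1_gN1_contragredient : contragredient
     (eigenpiece pi eps 0) (eigenpiece pi eps 1) (eigenpiece pi eps (-1)))
  (* t, canonical generators of g_[0], and H_0, E_0, F_0 *)
  (t : {vspace g}) (l : nat) (psi : 'I_l.+1 -> dual t)
  (H : 'I_l.+1 -> subvs_of t) (E F : 'I_l.+1 -> g)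
  (t_sub_h : (t <= h)%VS)
  (t_cartan : cartan_subalgebra (eigenpiece pi eps 0) t)
  (HEF_canonical : canonical_generators (eigenpiece pi eps 0)
     (fun j : 'I_l => psi (lift ord0 j)) (fun j => H (lift ord0 j))
     (fun j => E (lift ord0 j)) (fun j => F (lift ord0 j)))
  (E0_lowest : extremal_weight_vector (eigenpiece pi eps 1)
     (fun j : 'I_l => F (lift ord0 j)) (psi ord0) (E ord0))
  (F0_highest : exists lambda : dual t,
     extremal_weight_vector (eigenpiece pi eps (-1))
       (fun j : 'I_l => E (lift ord0 j)) lambda (F ord0))
  (H0_def : vsval (H ord0) = [lie E ord0, F ord0])
  (H0E0 : [lie vsval (H ord0), E ord0] = 2 *: E ord0)
  (* the affine Cartan matrix and its labels *)
  (A : 'M[int]_l.+1) (a a1 : 'I_l.+1 -> nat)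
  (A_def : forall i j, (A i j)%:~R = psi j (H i) :> R[i])
  (A_affine : affine_cartan_matrix R A)
  (a_labels : coprime_positive a) (a1_labels : coprime_positive a1)
  (A_a : forall i, \sum_j A i j * (a j)%:Z = 0)
  (a1_A : forall j, \sum_i (a1 i)%:Z * A i j = 0)
  (a_0 : a ord0 = 1%N)
  (* normalization of the form *)
  (B_nonsingular_t : (t :&: orthov B t)%VS = 0%VS)
  (B_normalized : dual_form B (psi ord0) (psi ord0) = 2 * (a1 ord0)%:R / K%:R)
  (* theta *)
  (m : nat) (omega : R[i]) (theta : 'End(g))
  (m_def : m = (K * \sum_j a j)%N) (omega_prim : m.-primitive_root omega)
  (theta_aut : automorphism theta) (theta_order : has_order theta m)
  (theta_H : forall j, theta (vsval (H j)) = vsval (H j))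
  (theta_E : forall j, theta (E j) = omega *: E j)
  (* the Chevalley involution *)
  (w : 'End(g)) (w_chevalley : chevalley_involution hh e f w)
  (* the isomorphism *)
  (phi : affine g -> affine g)
  (phi_iso : affine_isomorphism B pi eps K theta omega m phi)
  (phi_E : forall j : 'I_l,
     phi (E (lift ord0 j) \*t^ 0) = E (lift ord0 j) \*t^ 1)
  (phi_F : forall j : 'I_l,
     phi (F (lift ord0 j) \*t^ 0) = F (lift ord0 j) \*t^ (-1))
  (phi_H : forall j : 'I_l, let i := lift ord0 j in
     phi (vsval (H i) \*t^ 0) = vsval (H i) \*t^ 0
       + (2 * (dual_form B (psi i) (psi i))^-1 * m%:R^-1) *: affineC)
  (phi_E0 : phi (E ord0 \*t^ 1) = E ord0 \*t^ 1)
  (phi_F0 : phi (F ord0 \*t^ (-1)) = F ord0 \*t^ (-1))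
  (phi_H0 : phi (vsval (H ord0) \*t^ 0
                 + (B (E ord0) (F ord0) / K%:R) *: affineC)
     = vsval (H ord0) \*t^ 0
       + (2 * (dual_form B (psi ord0) (psi ord0))^-1 * m%:R^-1) *: affineC) :
  phi affineC = affineC /\
  exists N : dual t -> int,
  [/\ (* (2) *)
      forall (al : dual t) (r0 : int) (x : g), real_root_vector pi eps al r0 x ->
        phi (x \*t^ r0) = x \*t^ (N al + (m %/ K)%N%:Z * r0),
      (* (3) *)
      forall (al : dual t) (s : int) (x : g), real_root_vector pi eps al s x ->
        forall r0 : int, [lie x, w x] \in eigenpiece pi eps r0 ->
        phi ([lie x, w x] \*t^ r0) = [lie x, w x] \*t^ ((m %/ K)%N%:Z * r0)
          + (B x (w x) * ((N al)%:~R / m%:R) * (r0 == 0)%:R) *: affineC,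
      (* (4) *)
      forall (al be : dual t) (r0 s0 : int) (x y : g),
        real_root_vector pi eps al r0 x -> real_root_vector pi eps be s0 y ->
        B x y != 0 -> N al + N be = 0
    & (* (5) *)
      forall (al be : dual t) (r0 s0 : int) (x y : g),
        real_root_vector pi eps al r0 x -> real_root_vector pi eps be s0 y ->
        B x y = 0 ->
        phi ([lie x, y] \*t^ (r0 + s0))
          = [lie x, y] \*t^ ((r0 + s0) * (m %/ K)%N%:Z + N al + N be)].
Proof.
have pi_aut : automorphism pi by have [] := pi_diagram.
have [t_sub t_subalg _ _] := t_cartan.
have [[_ psi_basis _] memEF EF psiH' _] := HEF_canonical.
have [E0mem E0_neq0 wE0 _] := E0_lowest.
have [lam [F0mem F0_neq0 wF0 _]] := F0_highest.
have [a1_pos _] := a1_labels.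
have HEF i : vsval (H i) = [lie E i, F i].
  by case: (unliftP ord0 i) => [j|] -> //; rewrite EF eqxx.
have wE i : weight_vector (psi i) (E i).
  by case: (unliftP ord0 i) => [j|] -> //; have [] := memEF j.
have psiH i : (psi i (H i) : R[i]) = 2.
  case: (unliftP ord0 i) => [j|] ->; first exact: psiH'.
  have := H0E0; rewrite wE0 => /eqP; rewrite -subr_eq0 -scalerBl.
  by rewrite scaler_eq0 (negPf E0_neq0) orbF subr_eq0 => /eqP.
have H_neq0 i : H i != 0.
  by apply/eqP => Hi; have /eqP := psiH i; rewrite Hi linear0 eq_sym pnatr_eq0.
have t_abelian : forall u v : subvs_of t, [lie vsval u, vsval v] = 0.
  apply: (torus_abelian psi_basis wE t_subalg) => i.
  apply: contraNneq (H_neq0 i) => Ei; apply/eqP/val_inj.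
  by rewrite /= HEF Ei lie0l.
have wF i : weight_vector (- psi i) (F i).
  case: (unliftP ord0 i) => [j|] ->; first by have [] := memEF j.
  suff -> : - psi ord0 = lam by [].
  apply/eqP; rewrite eq_sym -addr_eq0 addrC; apply/eqP/lfunP => u.
  have := weight_vector_lie wE0 wF0 u; rewrite -HEF t_abelian => /esym/eqP.
  rewrite scaler_eq0 (inj_eq val_inj (H ord0) 0) (negPf (H_neq0 _)) orbF.
  by rewrite zero_lfunE => /eqP.
have deg_lift (j : 'I_l) : (lift ord0 j == ord0)%:Z = 0 by [].
have deg_0 : (ord0 == ord0 :> 'I_l.+1)%:Z = 1 by [].
have E_piece i : E i \in eigenpiece pi eps (i == ord0)%:Z.
  case: (unliftP ord0 i) => [j|] ->; first by rewrite deg_lift; have [] := memEF j.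
  by rewrite deg_0.
have F_piece i : F i \in eigenpiece pi eps (- (i == ord0)%:Z).
  case: (unliftP ord0 i) => [j|] ->; last by rewrite deg_0.
  by rewrite deg_lift oppr0; have [] := memEF j.
have phiE i : phi (E i \*t^ (i == ord0)%:Z) = E i \*t^ 1.
  case: (unliftP ord0 i) => [j|] ->; last by rewrite deg_0.
  by rewrite deg_lift.
have phiF i : phi (F i \*t^ (- (i == ord0)%:Z)) = F i \*t^ (-1).
  case: (unliftP ord0 i) => [j|] ->; last by rewrite deg_0.
  by rewrite deg_lift oppr0.
have A_a' i : \sum_j (psi j (H i) : R[i]) *+ a j = 0.
  apply: etrans (congr1 (fun c : int => c%:~R : R[i]) (A_a i)).
  by rewrite rmorph_sum; apply: eq_bigr => j _; rewrite rmorphM /= A_def mulr_natr.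
have a1_A' j : \sum_i (psi j (H i) : R[i]) *+ a1 i = 0.
  apply: etrans (congr1 (fun c : int => c%:~R : R[i]) (a1_A j)).
  by rewrite rmorph_sum; apply: eq_bigr => i _; rewrite rmorphM /= A_def mulr_natl.
have irr0 := simple_algebra_module g0_simple.
have gen0 := canonical_generators_EF HEF_canonical.
have K_gt0 : (0 < K)%N := prim_order_gt0 eps_prim.
have mK : (m %/ K)%N = (\sum_j a j)%N by rewrite m_def mulKn.
have phiC : phi affineC = affineC.
  exact: (phi_center phi_iso B_invariant eps_prim t_sub B_nonsingular_t psi_basis
    E_piece F_piece wE HEF psiH a_0 a1_pos A_a' a1_A' m_def phiE phiF).
split=> //.
have [rho [psi_rho [crho phi_rho]]] := height_element phi_iso B_invariant t_sub
  B_nonsingular_t psi_basis E_piece F_piece wE HEF psiH phiE phiF.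
(* For the weight al of a root vector al(rho) is an integer, and the floor of its
   real part returns that integer. *)
pose N (al : dual t) : int := Num.floor (complex.Re (al rho)).
have N_rho (al : dual t) (q : int) : (al rho : R[i]) = q%:~R -> N al = q.
  by rewrite /N => ->; rewrite -(rmorph_int (real_complex R)) /= intrKfloor.
exists N; rewrite mK.
have root_bracket := phi_root_bracket phi_iso B_invariant pi_aut K123 eps_prim
  irr0 g1_irr gN1_irr t_sub t_abelian B_nonsingular_t psi_basis E_piece F_piece
  wE wF HEF psiH gen0 a_0 a1_pos A_a' a1_A' m_def phiE phiF psi_rho phi_rho N_rho.
split.
- move=> al r0 x.
  exact: (phi_real_root_height phi_iso B_invariant pi_aut K123 eps_prim
    irr0 g1_irr gN1_irr t_sub t_abelian B_nonsingular_t psi_basis E_piece F_piece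
    wE wF HEF psiH gen0 a_0 a1_pos A_a' a1_A' m_def phiE phiF psi_rho phi_rho N_rho).
- move=> al s x xroot r0 xwx; have [xs _ wx _] := xroot.
  apply: (phi_coroot_vector phi_iso B_invariant pi_aut K123 eps_prim
    irr0 g1_irr gN1_irr t_sub t_abelian B_nonsingular_t psi_basis E_piece F_piece
    wE wF HEF psiH gen0 a_0 a1_pos A_a' a1_A' m_def phiE phiF psi_rho phi_rho N_rho
    xroot _ _ xwx).
    exact: (chevalley_eigenpiece hef_canonical w_chevalley pi_diagram).
  exact: (chevalley_weight_vector g_simple hef_canonical w_chevalley).
- move=> al be r0 s0 x y xroot yroot Bxy.
  have [_ _ wx _] := xroot; have [_ _ wy _] := yroot.
  apply: (height_opposite phi_iso B_invariant pi_aut K123 eps_prim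
    irr0 g1_irr gN1_irr t_sub t_abelian B_nonsingular_t psi_basis E_piece F_piece
    wE wF HEF psiH gen0 a_0 a1_pos A_a' a1_A' m_def phiE phiF psi_rho phi_rho N_rho
    xroot yroot).
  exact: weight_pairing B_invariant wx wy Bxy.
- move=> al be r0 s0 x y xroot yroot Bxy.
  by have := root_bracket al be r0 s0 x y xroot yroot; rewrite Bxy !mul0r scale0r !addr0.
Qed.
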